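(* Let $P\subset\mathbb{R}^3$ be a smooth $3$-dimensional lattice polytope with the origin in its interior, and suppose that the origin is next to a certain edge $uv$ of $P$. Then $\mathcal{E}(P)$ contains a lattice basis, i.e. a $\mathbb{Z}$-basis of $\mathbb{Z}^3$.
   Context: A $3$-dimensional polytope in $\mathbb{R}^3$ is smooth if it is simple, rational, and the primitive edge-direction vectors at each vertex form a basis of $\mathbb{Z}^3$; it is a lattice polytope if its vertices are in $\mathbb{Z}^3$. $\mathcal{E}(P):=\mathbb{Z}^3\cap P\cap(-P)$. The lattice distance from $x_0$ to a facet with affine hull $\{x:w\cdot x=b\}$, $w\in\mathbb{Z}^3$ primitive, is $|b-w\cdot x_0|$. For a face $F$ of $P$ and $x_0\in P$, the distance from $x_0$ to $F$ is the maximum of the lattice distances from $x_0$ to the facets containing $F$. The point $x_0$ is next to $F$ if it is in the interior of $P$ and at distance one from $F$. *)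

(* Defs.v *)
From mathcomp Require Export all_boot all_order all_algebra.
From mathcomp Require Export boolp classical_sets functions cardinality reals.
From mathcomp Require Export topology normedtype.
Export Order.TTheory GRing.Theory Num.Theory numFieldNormedType.Exports.

Set Implicit Arguments.
Unset Strict Implicit.
Unset Printing Implicit Defensive.

Local Open Scope classical_set_scope.
Local Open Scope ring_scope.

Section Affine.
Variables (R : realType) (n : nat).
Implicit Types (A : set 'rV[R]_n) (x y : 'rV[R]_n).

Definition dot x y : R := \sum_(i < n) x 0 i * y 0 i.

Definition affine_hull A : set 'rV[R]_n :=
  [set x | exists (k : nat) (p : 'I_k -> 'rV[R]_n) (c : 'I_k -> R),
    [/\ forall i, A (p i), \sum_i c i = 1 & x = \sum_i c i *: p i]].

Definition convex_hull A : set 'rV[R]_n :=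
  [set x | exists (k : nat) (p : 'I_k -> 'rV[R]_n) (c : 'I_k -> R),
    [/\ forall i, A (p i), forall i, 0 <= c i, \sum_i c i = 1
      & x = \sum_i c i *: p i]].

Definition segment x y : set 'rV[R]_n := convex_hull [set x; y].

(* The affine hull of A is a translate of a d-dimensional linear subspace (the
   row space of a matrix D with d independent rows); A is then nonempty. *)
Definition has_dim A (d : nat) : Prop :=
  exists (x0 : 'rV[R]_n) (D : 'M[R]_(d, n)),
    row_free D /\ affine_hull A = [set x0 + a *m D | a in setT].

Definition polytope A : Prop :=
  exists V : set 'rV[R]_n, finite_set V /\ A = convex_hull V.

(* The choice w = 0 gives the improper faces: P itself and the empty set. *)
Definition is_face (P F : set 'rV[R]_n) : Prop :=
  exists (w : 'rV[R]_n) (b : R),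
    (forall x, P x -> dot w x <= b) /\ F = P `&` [set x | dot w x = b].

Definition is_vertex (P : set 'rV[R]_n) v : Prop := is_face P [set v].

Definition is_edge (P F : set 'rV[R]_n) : Prop := is_face P F /\ has_dim F 1.

Definition toR (z : 'rV[int]_n) : 'rV[R]_n := map_mx intr z.

Definition lattice : set 'rV[R]_n := range toR.

End Affine.

Arguments toR {R n} z.
Arguments lattice {R n}.

Definition primitive_vector n (z : 'rV[int]_n) : Prop :=
  \big[gcdz/0]_(i < n) z 0 i = 1.

(* The rows of B form a basis of the Z-module Z^n. *)
Definition lattice_basis n (B : 'M[int]_n) : Prop :=
  forall z : 'rV[int]_n, exists! c : 'rV[int]_n, z = c *m B.

Section Polytope3.
Variable R : realType.
Implicit Types (P F G : set 'rV[R]_3) (v x : 'rV[R]_3).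

Definition is_facet P F : Prop := is_face P F /\ has_dim F 2.

Definition simple_polytope P : Prop :=
  forall v, is_vertex P v -> ([set F | is_edge P F /\ F v] #= `I_3)%card.

Definition rational_polytope P : Prop :=
  forall G, is_facet P G -> exists (w : 'rV[int]_3) (b : R),
    w != 0 /\ affine_hull G = [set x | dot (toR w) x = b].

Definition edge_direction P v (z : 'rV[int]_3) : Prop :=
  primitive_vector z /\
  exists l : R, 0 < l /\ is_edge P (segment v (v + l *: toR z)).

Definition smooth_polytope P : Prop :=
  [/\ simple_polytope P, rational_polytope P
    & forall v, is_vertex P v -> exists B : 'M[int]_3,
        lattice_basis B /\
        forall z, edge_direction P v z <-> exists i, z = row i B].

Definition lattice_polytope P : Prop := forall v, is_vertex P v -> lattice v.

(* d is the lattice distance from x to the facet G; w is determined up to sign,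
   hence d is determined. *)
Definition facet_distance G x (d : R) : Prop :=
  exists (w : 'rV[int]_3) (b : R),
    [/\ primitive_vector w, affine_hull G = [set y | dot (toR w) y = b]
      & d = `|b - dot (toR w) x|].

Definition facet_distances P F x : set R :=
  [set d | exists G, [/\ is_facet P G, F `<=` G & facet_distance G x d]].

Definition face_distance P F x (d : R) : Prop :=
  facet_distances P F x d /\ ubound (facet_distances P F x) d.

Definition next_to P F x : Prop :=
  interior P x /\ face_distance P F x 1.

Definition calE P : set 'rV[R]_3 :=
  lattice `&` P `&` [set - x | x in P].

End Polytope3.

(* Main.v *)
Require Import Defs.
From mathcomp Require Import ring lra zify.

Set Implicit Arguments.
Unset Strict Implicit.
Unset Printing Implicit Defensive.

Local Open Scope classical_set_scope.
Local Open Scope ring_scope.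

(** At a vertex w of a smooth lattice polytope P the primitive edge directions
r1, r2, r3 form a lattice basis, P lies in w + cone(r1, r2, r3), and each edge
ends at a vertex w + n r_i with n a positive integer. This is the notion [frame],
and it is all that is used of smoothness.

Let p, q, e be the edge directions at u, with e along uv, and use them as
coordinate axes. The two facets through uv are x = ux and y = uy, so the origin is
next to uv exactly when u = (-1, -1, a); here a < 0, and P lies in x >= -1,
y >= -1, z >= a. Since P meets the planes x = 0 and y = 0 right after two facets,
points of P whose opposite is in P are sought over (0, 0), (0, 1) and (1, 0): if
(0, 0, 1), (0, 1, t), (1, 0, s) and their opposites are in P, the three vectors
form the required basis.

The axis ([axis_depth]). The facet z = a contains (-1, -1), (0, -1), (-1, 0). Either
it also contains (0, 0), and then (0, 0, -1) is in P by convexity, or it is a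
unimodular triangle. In the latter case the layer z = a + 1 is large enough to
settle a <= -2, and when a = -1 the origin is also next to the edge at u in
direction p, for which both axis points are in P: that edge then replaces uv. The
same argument at v ([edge_flip]) yields (0, 0, 1).

The column over (0, 1) ([symmetric_in_column]). The column over (0, -1) contains
all heights between a and some integer m, the latter given by v. So an integer t
between -m and -a is needed in the column over (0, 1). The slice x = 0 is a lattice
polygon ([slice_vertexP]), hence has a lattice point with y >= 1; together with the
points (0, 0, 1) and (0, 0, -1) this gives an integer in the column over (0, 1).
It remains to see that this column reaches down to -a, and by symmetry up to -m.

That is [opposite_below]. If the column stayed above -a, the lowest point
C = (0, 0, l) of P on the axis would be a lattice point and a vertex of the slice,
at which the slope of the lower boundary increases by more than -2 l, hence by more
than 2. If C is inside an edge of P crossing x = 0, the slice is unimodular at C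
and the slope increases by at most 1. If C is a vertex of P, let m be the
coordinates of (0, 0, 1) and a' those of (0, -1, a) - C in the frame of C; one a'_i
vanishes because (0, -1, a) is on the boundary, and the increase of slope is the
largest a'_i / m_i. Unimodularity and the inequalities x >= -1 at the neighbours of
C bound it by 2 ([ray_weight_le]).

The remaining parts derive frames and slices from the definition of a polytope
as a convex hull, by perturbing affine functionals lexicographically. *)

(** * Three-dimensional linear algebra over the integers *)

Definition row3 (T : Type) (x y z : T) : 'rV[T]_3 :=
  \row_i (if i == 0 then x else if i == 1 then y else z).

Definition rows3 (T : Type) (r1 r2 r3 : 'rV[T]_3) : 'M[T]_3 :=
  \matrix_(i, j) (row3 (r1 0 j) (r2 0 j) (r3 0 j)) 0 i.

(** Kept as a polynomial, so that Cramer's rule and integrality of coordinates are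
ring identities. *)
Definition det3 (A : comPzRingType) (x1 y1 z1 x2 y2 z2 x3 y3 z3 : A) : A :=
  x1 * (y2 * z3 - z2 * y3) - y1 * (x2 * z3 - z2 * x3)
  + z1 * (x2 * y3 - y2 * x3).

Lemma big_ord3 (V : nmodType) (F : 'I_3 -> V) : \sum_i F i = F 0 + F 1 + F 2.
Proof.
rewrite !big_ord_recr big_ord0 /= add0r.
by congr (_ + _ + _); congr F; apply: val_inj.
Qed.

Lemma forall_ord3 (Pr : 'I_3 -> Prop) : Pr 0 -> Pr 1 -> Pr 2 -> forall i, Pr i.
Proof.
move=> h0 h1 h2; case=> [[|[|[|//]]]] Hi.
- by have -> : Ordinal Hi = 0 by apply: val_inj.
- by have -> : Ordinal Hi = 1 by apply: val_inj.
- by have -> : Ordinal Hi = 2 by apply: val_inj.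
Qed.

Lemma row3E (T : Type) (v : 'rV[T]_3) : v = row3 (v 0 0) (v 0 1) (v 0 2).
Proof. by apply/rowP; apply: forall_ord3; rewrite !mxE. Qed.

Lemma mul_row3 (A : pzSemiRingType) (x y z : A) (r1 r2 r3 : 'rV[A]_3) :
  row3 x y z *m rows3 r1 r2 r3 = x *: r1 + y *: r2 + z *: r3.
Proof. by apply/rowP => j; rewrite !mxE big_ord3 !mxE. Qed.

Lemma det_rows3 (A : comPzRingType) (r1 r2 r3 : 'rV[A]_3) :
  \det (rows3 r1 r2 r3) =
  det3 (r1 0 0) (r1 0 1) (r1 0 2) (r2 0 0) (r2 0 1) (r2 0 2)
       (r3 0 0) (r3 0 1) (r3 0 2).
Proof.
rewrite (expand_det_row _ 0) big_ord3 /cofactor.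
rewrite !(expand_det_row _ 0) !big_ord_recr !big_ord0 /= /cofactor !det_mx11.
have e0 : widen_ord (leqnSn 1) ord_max = 0 :> 'I_2 by apply: val_inj.
have e1 : ord_max = 1 :> 'I_2 by apply: val_inj.
rewrite !e0 !e1 !mxE /=.
have l00 : lift (0 : 'I_3) (0 : 'I_2) = 1 by apply: val_inj.
have l01 : lift (0 : 'I_3) (1 : 'I_2) = 2 by apply: val_inj.
have l10 : lift (1 : 'I_3) (0 : 'I_2) = 0 by apply: val_inj.
have l11 : lift (1 : 'I_3) (1 : 'I_2) = 2 by apply: val_inj.
have l20 : lift (2 : 'I_3) (0 : 'I_2) = 0 by apply: val_inj.
have l21 : lift (2 : 'I_3) (1 : 'I_2) = 1 by apply: val_inj.
have l2 : lift (0 : 'I_2) (0 : 'I_1) = 1 by apply: val_inj.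
have l3 : lift (1 : 'I_2) (0 : 'I_1) = 0 by apply: val_inj.
rewrite !l2 !l3 !l00 !l01 !l10 !l11 !l20 !l21 /= /det3.
rewrite /bump /= !expr0 !expr1 !expr2 /=; ring.
Qed.

Section Cramer.
Variables (A : comPzRingType) (x1 y1 z1 x2 y2 z2 x3 y3 z3 d : A).
Hypothesis d1 : d * det3 x1 y1 z1 x2 y2 z2 x3 y3 z3 = 1.

Lemma cramer3 X Y Z a b c :
  X = a * x1 + b * x2 + c * x3 -> Y = a * y1 + b * y2 + c * y3 ->
  Z = a * z1 + b * z2 + c * z3 ->
  [/\ a = d * det3 X Y Z x2 y2 z2 x3 y3 z3,
      b = d * det3 x1 y1 z1 X Y Z x3 y3 z3
    & c = d * det3 x1 y1 z1 x2 y2 z2 X Y Z].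
Proof.
move=> -> -> ->; split.
- rewrite -[LHS]mul1r -d1 /det3; ring.
- rewrite -[LHS]mul1r -d1 /det3; ring.
- rewrite -[LHS]mul1r -d1 /det3; ring.
Qed.

Lemma cramer3_sol X Y Z (a := d * det3 X Y Z x2 y2 z2 x3 y3 z3)
  (b := d * det3 x1 y1 z1 X Y Z x3 y3 z3)
  (c := d * det3 x1 y1 z1 x2 y2 z2 X Y Z) :
  [/\ X = a * x1 + b * x2 + c * x3, Y = a * y1 + b * y2 + c * y3
    & Z = a * z1 + b * z2 + c * z3].
Proof.
rewrite /a /b /c; split.
- rewrite -[LHS]mul1r -d1 /det3; ring.
- rewrite -[LHS]mul1r -d1 /det3; ring.
- rewrite -[LHS]mul1r -d1 /det3; ring.
Qed.

End Cramer.

(** The bound on the change of slope. Put D = x1 y2 - x2 y1, which is m3 up to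
sign. Solving for the rays gives x2 = a1 D and x1 = - a2 D. If a1 > 2 m1 then
a1 >= 3, so x1, x2 >= -1 and a1 y1 + a2 y2 = -1 leave only
D = m3 = 1, a2 = 1, x1 = -1, x2 = a1; then
x3 >= -1 makes m1 >= a1 m2 - 1 >= a1 - 1, which is too large. *)
Lemma ray_weight_le (x1 y1 x2 y2 x3 m1 m2 m3 a1 a2 : int) :
  -1 <= x1 -> -1 <= x2 -> -1 <= x3 -> 0 < m1 -> 0 < m2 -> 0 < m3 ->
  0 <= a1 -> 0 <= a2 -> a1 * x1 + a2 * x2 = 0 -> a1 * y1 + a2 * y2 = -1 ->
  m1 * x1 + m2 * x2 + m3 * x3 = 0 ->
  x1 * y2 - x2 * y1 = m3 \/ x1 * y2 - x2 * y1 = - m3 ->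
  a1 <= 2 * m1.
Proof.
move=> hx1 hx2 hx3 hm1 hm2 hm3 ha1 ha2 ex ey em D.
case: (lerP a1 (2 * m1)) => // lt.
have E2 : a1 * (x1 * y2 - x2 * y1) = x2.
  have -> : a1 * (x1 * y2 - x2 * y1) = (a1 * x1 + a2 * x2) * y2 - x2 * (a1 * y1 + a2 * y2) by ring.
  by rewrite ex ey; ring.
have E1 : a2 * (x1 * y2 - x2 * y1) = - x1.
  have -> : a2 * (x1 * y2 - x2 * y1) = x1 * (a1 * y1 + a2 * y2) - y1 * (a1 * x1 + a2 * x2) by ring.
  by rewrite ex ey; ring.
case: D => D; rewrite D in E1 E2; last by nia.
have a2m3 : a2 * m3 <= 1 by lia.
have [a20|a21] : a2 = 0 \/ (a2 = 1 /\ m3 = 1) by nia.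
  have : a1 * y1 = -1 by move: ey; rewrite a20; lia.
  nia.
case: a21 => a21 m31; subst a2 m3.
have ma : a1 <= m2 * a1 by nia.
have ex1 : x1 = -1 by lia.
have ex2 : x2 = a1 by lia.
subst x1 x2; lia.
Qed.

(** * Convex hulls and affine functionals *)

Section Hull.
Variables (R : realType) (n : nat).
Implicit Types (A V : set 'rV[R]_n) (x y w s : 'rV[R]_n) (a b h f : 'rV[R]_n * R).

Lemma dotDr w x y : dot w (x + y) = dot w x + dot w y.
Proof. by rewrite -big_split; apply: eq_bigr => i _; rewrite mxE mulrDr. Qed.
Lemma dotZr w k x : dot w (k *: x) = k * dot w x.
Proof. by rewrite mulr_sumr; apply: eq_bigr => i _; rewrite mxE mulrCA. Qed.
Lemma dotNr w x : dot w (- x) = - dot w x.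
Proof. by rewrite -scaleN1r dotZr mulN1r. Qed.
Lemma dotBr w x y : dot w (x - y) = dot w x - dot w y.
Proof. by rewrite dotDr dotNr. Qed.
Lemma dot0r w : dot w 0 = 0.
Proof. by rewrite -(scale0r 0) dotZr mul0r. Qed.
Lemma dotC w x : dot w x = dot x w.
Proof. by apply: eq_bigr => i _; rewrite mulrC. Qed.
Lemma dotDl w x y : dot (x + y) w = dot x w + dot y w.
Proof. by rewrite dotC dotDr !(dotC w). Qed.
Lemma dotZl w k x : dot (k *: x) w = k * dot x w.
Proof. by rewrite dotC dotZr (dotC w). Qed.
Lemma dotNl w x : dot (- x) w = - dot x w.
Proof. by rewrite dotC dotNr (dotC w). Qed.
Lemma dot_delta (i : 'I_n) x : dot (delta_mx 0 i) x = x 0 i.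
Proof.
rewrite /dot (bigD1 i) //= mxE !eqxx mul1r big1 ?addr0 // => j ji.
by rewrite mxE (negbTE ji) andbF mul0r.
Qed.
Lemma dot_sumr w (k : nat) (c : 'I_k -> R) (p : 'I_k -> 'rV[R]_n) :
  dot w (\sum_i c i *: p i) = \sum_i c i * dot w (p i).
Proof.
elim/big_ind2: _ => [|x1 r1 x2 r2 e1 e2|i _]; first exact: dot0r.
  by rewrite dotDr e1 e2.
exact: dotZr.
Qed.
Lemma dot_gt0 x : x != 0 -> 0 < dot x x.
Proof.
move=> x0; rewrite lt_neqAle sumr_ge0 => [|i _]; last by rewrite -expr2 sqr_ge0.
rewrite andbT eq_sym; apply: contra x0 => /eqP/psumr_eq0P h.
apply/eqP/rowP => i; rewrite mxE; apply/eqP.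
by rewrite -[_ == _]orbb -mulf_eq0; apply/eqP/h => // j _; rewrite -expr2 sqr_ge0.
Qed.

Definition aff a x : R := dot a.1 x + a.2.

Lemma aff_sum a (k : nat) (c : 'I_k -> R) (p : 'I_k -> 'rV[R]_n) :
  \sum_i c i = 1 -> aff a (\sum_i c i *: p i) = \sum_i c i * aff a (p i).
Proof.
move=> c1; rewrite /aff dot_sumr -[a.2 in LHS]mul1r -c1 mulr_suml -big_split.
by apply: eq_bigr => i _; rewrite /= mulrDr.
Qed.

Lemma sub_hull A : A `<=` convex_hull A.
Proof.
move=> x Ax; exists 1%N, (fun=> x), (fun=> 1); split=> //.
  by rewrite big_ord1.
by rewrite big_ord1 scale1r.
Qed.

Lemma hull_convex A x y (s t : R) : convex_hull A x -> convex_hull A y ->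
  0 <= s -> 0 <= t -> s + t = 1 -> convex_hull A (s *: x + t *: y).
Proof.
move=> [k [p [c [Ap c0 c1 ->]]]] [l [q [d [Aq d0 d1 ->]]]] s0 t0 st.
exists (k + l)%N, (fun i => match fintype.split i with inl i => p i | inr i => q i end),
  (fun i => match fintype.split i with inl i => s * c i | inr i => t * d i end).
have sl i : fintype.split (lshift l i) = inl i by exact: (unsplitK (inl i)).
have sr i : fintype.split (rshift k i) = inr i by exact: (unsplitK (inr i)).
split.
- by move=> i; case: fintype.split.
- by move=> i; case: fintype.split => j; rewrite mulr_ge0.
- rewrite big_split_ord /=; under eq_bigr do rewrite sl.
  under [X in _ + X]eq_bigr do rewrite sr.
  by rewrite -!mulr_sumr c1 d1 !mulr1.
- rewrite big_split_ord /=; under [X in _ = _ + X]eq_bigr do rewrite sr.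
  under [X in _ = X + _]eq_bigr do rewrite sl.
  by rewrite !scaler_sumr; congr (_ + _); apply: eq_bigr => i _; rewrite scalerA.
Qed.

Lemma hull_aff_ge0 A a x : (forall v, A v -> 0 <= aff a v) ->
  convex_hull A x -> 0 <= aff a x.
Proof.
move=> h [k [p [c [Ap c0 c1 ->]]]]; rewrite aff_sum //.
by apply: sumr_ge0 => i _; rewrite mulr_ge0 // h.
Qed.

Definition opp_aff a : 'rV[R]_n * R := (- a.1, - a.2).
Lemma aff_const (k : R) x : aff (0, k) x = k.
Proof. by rewrite /aff /= dotC dot0r add0r. Qed.

Lemma opp_affE a x : aff (opp_aff a) x = - aff a x.
Proof. by rewrite /aff /= dotNl opprD. Qed.

Definition comb_aff a (k : R) b : 'rV[R]_n * R := (a.1 + k *: b.1, a.2 + k * b.2).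
Lemma comb_affE a k b x : aff (comb_aff a k b) x = aff a x + k * aff b x.
Proof. by rewrite /aff /= dotDl dotZl; ring. Qed.

Lemma hull_aff_eq0 A a x : (forall v, A v -> aff a v = 0) ->
  convex_hull A x -> aff a x = 0.
Proof.
move=> h Ax; apply/eqP; rewrite eq_le.
rewrite (hull_aff_ge0 _ Ax) ?andbT => [|v Av]; last by rewrite h.
rewrite -oppr_ge0 -opp_affE (hull_aff_ge0 _ Ax) // => v Av.
by rewrite opp_affE h // oppr0.
Qed.

(** Points of zero weight may lie off the face; they are replaced by a point of
nonzero weight. *)
Lemma hull_face A a x : (forall v, A v -> 0 <= aff a v) ->
  convex_hull A x -> aff a x = 0 ->
  convex_hull (A `&` [set v | aff a v = 0]) x.
Proof.
move=> h [k [p [c [Ap c0 c1 ->]]]]; rewrite aff_sum // => /psumr_eq0P ax.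
have {}ax i : c i * aff a (p i) = 0.
  by apply: ax => // j _; rewrite mulr_ge0 // h.
have [i0 ci0] : exists i, c i != 0.
  apply: contrapT => nex; move: c1; rewrite big1 => [/eqP|i _].
    by rewrite eq_sym oner_eq0.
  by apply: contrapT => ci; apply: nex; exists i; apply/eqP.
have on i : c i != 0 -> aff a (p i) = 0.
  by move=> ci; move/eqP: (ax i); rewrite mulf_eq0 (negbTE ci) => /eqP.
exists k, (fun i => if c i == 0 then p i0 else p i), c; split=> //.
  by move=> i; case: eqVneq => ci; split=> //=; apply: on.
by apply: eq_bigr => i _; case: eqVneq => // ->; rewrite !scale0r.
Qed.

Lemma hull_nonempty A x : convex_hull A x -> exists v, A v.
Proof.
move=> [[|k] [p [c [Ap c0 c1 _]]]]; last by exists (p ord0).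
by move/eqP: c1; rewrite big_ord0 eq_sym oner_eq0.
Qed.

Lemma hull_face_point A a x : (forall v, A v -> 0 <= aff a v) ->
  convex_hull A x -> aff a x = 0 -> exists2 v, A v & aff a v = 0.
Proof. by move=> h Ax ax; have [v []] := hull_nonempty (hull_face h Ax ax); exists v. Qed.

Lemma line_comb x y (t : R) : x + t *: (y - x) = (1 - t) *: x + t *: y.
Proof. by apply/rowP => i; rewrite !mxE; ring. Qed.

Lemma sum_on_line (k : nat) (p : 'I_k -> 'rV[R]_n) (c t : 'I_k -> R) x d :
  (forall i, p i = x + t i *: d) -> \sum_i c i = 1 ->
  \sum_i c i *: p i = x + (\sum_i c i * t i) *: d.
Proof.
move=> hp c1; under eq_bigr do rewrite hp scalerDr scalerA.
by rewrite big_split /= -!scaler_suml c1 scale1r.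
Qed.

Lemma segmentP x y z : segment x y z <->
  exists t : R, [/\ 0 <= t, t <= 1 & z = x + t *: (y - x)].
Proof.
split=> [[k [p [c [pxy c0 c1 ->]]]]|[t [t0 t1 ->]]].
  pose T i : R := if p i == y then 1 else 0.
  have T01 i : 0 <= T i <= 1 by rewrite /T; case: ifP; rewrite ?lexx ?ler01.
  exists (\sum_i c i * T i); split.
  - by apply: sumr_ge0 => i _; have /andP[? _] := T01 i; rewrite mulr_ge0.
  - rewrite -c1; apply: ler_sum => i _; have /andP[_ ?] := T01 i.
    by rewrite -[leRHS]mulr1 ler_wpM2l.
  - apply: sum_on_line => // i; rewrite /T; case: eqVneq => [->|py].
      by rewrite scale1r addrC subrK.
    have [->|/= pe] := pxy i; first by rewrite scale0r addr0.
    by rewrite pe eqxx in py.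
rewrite line_comb.
by apply: hull_convex; rewrite ?subr_ge0 ?subrK //; apply: sub_hull; [left|right].
Qed.

Lemma segment_dim1 x y : x != y -> has_dim (segment x y) 1.
Proof.
move=> xy; have d0 : y - x != 0 by rewrite subr_eq0 eq_sym.
exists x, (y - x); split.
  apply: inj_row_free => v /eqP; rewrite [v]mx11_scalar mul_scalar_mx scaler_eq0.
  by rewrite (negbTE d0) orbF => /eqP ->; rewrite raddf0.
apply/seteqP; split=> z /=.
  move=> [k [p [c [hp c1 ->]]]].
  have /choice[t ht] i : exists t : R, p i = x + t *: (y - x).
    by have [t [_ _ ->]] := (segmentP x y (p i)).1 (hp i); exists t.
  by exists (\sum_i c i * t i)%:M => //; rewrite mul_scalar_mx (sum_on_line ht).
move=> [v _ <-]; rewrite [v]mx11_scalar mul_scalar_mx; set t := v 0 0.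
exists 2%N, (fun i => if i == ord0 then x else y), (fun i => if i == ord0 then 1 - t else t).
split.
- move=> i; apply: sub_hull; case: ifP => _; [by left|by right].
- by rewrite big_ord_recl big_ord1 /= subrK.
- by rewrite big_ord_recl big_ord1 /= line_comb.
Qed.

Lemma dim1_neq x y : has_dim (segment x y) 1 -> x != y.
Proof.
move=> [x0 [D [fD E]]]; apply/eqP => xy; subst y.
have sub z : affine_hull (segment x x) z -> z = x.
  move=> [k [p [c [hp c1 ->]]]].
  transitivity (\sum_i c i *: x); last by rewrite -scaler_suml c1 scale1r.
  apply: eq_bigr => i _; congr (_ *: _).
  by have [t [_ _ ->]] := (segmentP x x (p i)).1 (hp i); rewrite subrr scaler0 addr0.
have h v : x0 + v *m D = x by apply: sub; rewrite E; exists v.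
have D0 : D = 0.
  by have := h 1%:M; rewrite -(h 0) mul0mx mul1mx => /addrI.
by move: fD; rewrite D0 /row_free mxrank0.
Qed.

Lemma segmentC x y : segment x y = segment y x.
Proof. by rewrite /segment setUC. Qed.

End Hull.

(** * Vertices, edges and slices of a polytope *)

Section Seq.
Variable R : realType.

Lemma seq_argmin (T : eqType) (W : seq T) (f : T -> R) v0 : v0 \in W ->
  exists2 v, v \in W & forall v', v' \in W -> f v <= f v'.
Proof.
elim: W v0 => // w W IH v0 _; case: W IH => [|w' W] IH.
  by exists w; rewrite ?mem_head // => v'; rewrite inE => /eqP ->.
have [v vW hv] := IH _ (mem_head _ _).
have [wv|vw] := lerP (f w) (f v).
  exists w; rewrite ?mem_head // => v'; rewrite in_cons => /orP[/eqP -> //|/hv].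
  exact: le_trans.
exists v; first by rewrite in_cons vW orbT.
move=> v'; rewrite in_cons => /orP[/eqP ->|/hv //].
exact: ltW.
Qed.

Lemma seq_gap (L U : seq R) : (forall l u, l \in L -> u \in U -> l <= u) ->
  exists k, (forall l, l \in L -> l <= k) /\ (forall u, u \in U -> k <= u).
Proof.
move=> h; case: L h => [|l0 L] h.
  case: U h => [|u0 U] h; first by exists 0; split.
  have [u uU hu] := @seq_argmin _ (u0 :: U) id _ (mem_head _ _).
  by exists u; split.
have [l lL hl] := @seq_argmin _ (l0 :: L) -%R _ (mem_head _ _).
exists l; split=> [l' /hl|u uU]; first by rewrite lerN2.
exact: h.
Qed.

(** On a finite set the constraints that are strict at f survive a small move in
the direction of g; the others are controlled by the sign of g. *)
Lemma perturb (T : eqType) (W : seq T) (f g : T -> R) :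
  (forall v, v \in W -> 0 <= f v) ->
  (forall v, v \in W -> f v = 0 -> 0 <= g v) ->
  exists2 d : R, 0 < d & forall v, v \in W ->
    0 <= f v + d * g v /\ (f v + d * g v = 0 -> f v = 0 /\ g v = 0).
Proof.
move=> f0 g0; pose S := \sum_(v <- W) (if f v == 0 then 0 else (1 + `|g v|) / f v).
have term0 v : v \in W -> 0 <= (if f v == 0 then 0 else (1 + `|g v|) / f v).
  by move=> vW; case: ifP => // _; rewrite divr_ge0 ?f0 // addr_ge0.
have S0 : 0 <= S by rewrite /S big_seq_cond; apply: sumr_ge0 => v; rewrite andbT => /term0.
have d0 : 0 < (1 + S)^-1 by rewrite invr_gt0; lra.
exists (1 + S)^-1 => // v vW.
have [fv|fv] := eqVneq (f v) 0.
  have gv := g0 _ vW fv; rewrite fv add0r; split; first by rewrite mulr_ge0 // ltW.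
  by move/eqP; rewrite mulf_eq0 (gt_eqF d0) => /eqP.
suff : 0 < f v + (1 + S)^-1 * g v.
  by move=> h; split; [exact: ltW|move=> e; rewrite e ltxx in h].
have fp : 0 < f v by rewrite lt_neqAle eq_sym fv f0.
have Sv : (1 + `|g v|) / f v <= S.
  rewrite /S (big_rem _ vW) /= (negbTE fv) lerDl big_seq_cond.
  by apply: sumr_ge0 => w; rewrite andbT => /mem_rem/term0.
rewrite -(pmulr_rgt0 _ (_ : 0 < 1 + S)); last by lra.
rewrite mulrDr mulrA divff ?mul1r; last by rewrite gt_eqF //; lra.
rewrite ler_pdivrMr // in Sv.
have : - `|g v| <= g v by rewrite lerNl -normrN ler_norm.
lra.
Qed.

End Seq.

Section Faces.
Variables (R : realType) (n : nat).
Implicit Types (V W : seq 'rV[R]_n) (x y w s : 'rV[R]_n) (a b h f : 'rV[R]_n * R).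
Local Notation hull V := (convex_hull [set` V]).

Lemma hull_is_face V a : (forall v, v \in V -> 0 <= aff a v) ->
  is_face (hull V) (hull V `&` [set x | aff a x = 0]).
Proof.
move=> h; exists (- a.1), a.2; split=> [x Vx|].
  have := hull_aff_ge0 h Vx; rewrite /aff dotNl; lra.
by apply/seteqP; split=> x [Vx /= ex]; split=> //=; move: ex; rewrite /aff dotNl; lra.
Qed.

(** One step of lexicographic minimisation: the zero set of a shrinks to its points
of least ratio f / h, and a' stays nonnegative on W. The explicit form of a' keeps
track of its value outside W. *)
Lemma refine W a h f v0 :
  (forall v, v \in W -> 0 <= aff a v) -> (forall v, v \in W -> 0 < aff h v) ->
  v0 \in W -> aff a v0 = 0 ->
  exists a' rho d, [/\ 0 < d /\ (forall x, aff a' x = aff a x + d * (aff f x - rho * aff h x)),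
    forall v, v \in W -> 0 <= aff a' v,
    exists2 v, v \in W & aff a' v = 0,
    forall v, v \in W -> aff a' v = 0 -> aff a v = 0 /\ aff f v = rho * aff h v
  & forall v, v \in W -> aff a v = 0 -> rho * aff h v <= aff f v].
Proof.
move=> a0 h0 v0W av0.
have [s] : exists2 s, s \in [seq v <- W | aff a v == 0] &
    forall v, v \in [seq v <- W | aff a v == 0] -> aff f s / aff h s <= aff f v / aff h v.
  by apply: (@seq_argmin _ _ _ (fun v => aff f v / aff h v) v0); rewrite mem_filter av0 eqxx.
rewrite mem_filter => /andP[/eqP as0 sW] smin.
pose rho := aff f s / aff h s.
have rho_le v : v \in W -> aff a v = 0 -> rho * aff h v <= aff f v.
  by move=> vW av; rewrite -ler_pdivlMr ?h0 // smin // mem_filter av eqxx.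
have g0 v : v \in W -> aff a v = 0 -> 0 <= aff (comb_aff f (- rho) h) v.
  by move=> vW av; have := rho_le v vW av; rewrite comb_affE; lra.
have [d d0 hd] := perturb a0 g0.
exists (comb_aff a d (comb_aff f (- rho) h)), rho, d; split=> //.
- by split=> // x; rewrite !comb_affE mulNr.
- by move=> v /hd[av _]; rewrite comb_affE.
- exists s => //; rewrite !comb_affE as0 mulNr divfK ?subrr ?mulr0 ?addr0 //.
  by rewrite gt_eqF // h0.
- move=> v /hd[_ av]; rewrite comb_affE => /av[-> e]; split=> //.
  by move: e; rewrite comb_affE; lra.
Qed.

Lemma refine_list W a h (fs : seq ('rV[R]_n * R)) v0 :
  (forall v, v \in W -> 0 <= aff a v) -> (forall v, v \in W -> 0 < aff h v) ->
  v0 \in W -> aff a v0 = 0 ->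
  exists a', [/\ forall v, v \in W -> 0 <= aff a' v,
    exists2 v, v \in W & aff a' v = 0,
    forall v, v \in W -> aff a' v = 0 -> aff a v = 0,
    forall v v' f, v \in W -> v' \in W -> f \in fs -> aff a' v = 0 -> aff a' v' = 0 ->
      aff f v * aff h v' = aff f v' * aff h v
  & forall x, aff a x = 0 -> aff h x = 0 -> (forall f, f \in fs -> aff f x = 0) ->
      aff a' x = 0].
Proof.
move=> a0 h0 v0W av0; elim: fs => [|f fs [a1 [a10 [v1 v1W av1] aa1 c1 z1]]].
  by exists a; split=> //; exists v0.
have [a' [rho [d [[d0 a'E] a'0 [v' v'W a'v] aa' _]]]] := refine f a10 h0 v1W av1.
exists a'; split=> //.
- by exists v'.
- by move=> v vW /(aa' v vW)[/(aa1 v vW)].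
- move=> v w g vW wW; rewrite inE => /orP[/eqP ->|gfs] av aw.
    by have [_ ->] := aa' v vW av; have [_ ->] := aa' w wW aw; ring.
  by apply: c1 => //; [have [] := aa' v vW av|have [] := aa' w wW aw].
- move=> x ax hx fx; rewrite a'E hx (fx f (mem_head _ _)) z1 //; first by ring.
  by move=> g gfs; apply: fx; rewrite inE gfs orbT.
Qed.

Definition coords x : seq ('rV[R]_n * R) := [seq (delta_mx 0 i, - x 0 i) | i <- enum 'I_n].

Lemma coords_in x i : (delta_mx 0 i, - x 0 i) \in coords x.
Proof. by apply: map_f; rewrite mem_enum. Qed.

Lemma coords_aff x i y : aff (delta_mx 0 i, - x 0 i) y = (y - x) 0 i.
Proof. by rewrite /aff /= dot_delta !mxE. Qed.

(** Minimising f and then all coordinates singles out one point of V. *)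
Lemma exposed_vertex V a f v0 : (forall v, v \in V -> 0 <= aff a v) ->
  v0 \in V -> aff a v0 = 0 ->
  exists s, [/\ s \in V, aff a s = 0, is_vertex (hull V) s
    & forall v, v \in V -> aff a v = 0 -> aff f s <= aff f v].
Proof.
move=> a0 v0V av0; pose h : 'rV[R]_n * R := (0, 1).
have hE x : aff h x = 1 by rewrite aff_const.
have h0 v : v \in V -> 0 < aff h v by rewrite hE.
have [a1 [rho [d [_ a10 [v1 v1V av1] aa1 fmin]]]] := refine f a0 h0 v0V av0.
have [a' [a'0 [s sV a's] aa' ca' _]] := refine_list (coords 0) a10 h0 v1V av1.
have [as_ fs] := aa1 s sV (aa' s sV a's).
exists s; split=> //; last first.
  by move=> v vV av; rewrite fs hE -[X in X * 1](mulr1) -{2}(hE v) mulr1 fmin.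
have uniq v : v \in V -> aff a' v = 0 -> v = s.
  move=> vV av; apply/rowP => i; have := ca' v s _ vV sV (coords_in 0 i) av a's.
  by rewrite !hE !coords_aff !subr0 !mulr1.
rewrite /is_vertex; suff -> : [set s] = hull V `&` [set x | aff a' x = 0] by exact: hull_is_face.
apply/seteqP; split=> x /= => [->|[Vx ax]].
  by split=> //; apply: sub_hull.
have Zx := hull_face a'0 Vx ax.
apply/rowP => i; apply/eqP; rewrite -subr_eq0.
have -> : x 0 i - s 0 i = (x - s) 0 i by rewrite !mxE.
rewrite -coords_aff; apply/eqP/(hull_aff_eq0 _ Zx) => v [vV av].
by rewrite coords_aff (uniq v) // subrr mxE.
Qed.

Lemma face_aff V F : is_face (hull V) F -> exists a,
  (forall v, v \in V -> 0 <= aff a v) /\ F = hull V `&` [set x | aff a x = 0].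
Proof.
move=> [w [b [hw ->]]]; exists (- w, b); split.
  by move=> v vV; have := hw v (sub_hull vV); rewrite /aff /= dotNl; lra.
by apply/seteqP; split=> x [Vx /= ex]; split=> //=; move: ex; rewrite /aff /= dotNl; lra.
Qed.

Lemma face_sub (P F : set 'rV[R]_n) : is_face P F -> F `<=` P.
Proof. by move=> [w [b [_ ->]]] x []. Qed.

Lemma vertex_in (P : set 'rV[R]_n) x : is_vertex P x -> P x.
Proof. by move/face_sub; apply. Qed.

Lemma edge_end V x y : x != y -> is_face (hull V) (segment x y) -> is_vertex (hull V) y.
Proof.
move=> xy /face_aff[a [a0 FE]].
have yF : segment x y y by apply: sub_hull; right.
have := yF; rewrite FE => -[Vy /= ay].
have [v0 v0V av0] := hull_face_point a0 Vy ay.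
pose f : 'rV[R]_n * R := (- (y - x), dot (y - x) x).
have [s [sV as_ sv smin]] := exposed_vertex f a0 v0V av0.
suff <- : s = y by [].
have sF : segment x y s by rewrite FE; split=> //=; apply: sub_hull.
have [t [t0 t1 sE]] := (segmentP x y s).1 sF.
have fE z : aff f z = - dot (y - x) (z - x) by rewrite /aff /= dotNl dotBr opprB addrC.
have : 0 <= aff (comb_aff f (-1) (0, aff f s)) y.
  apply: (hull_aff_ge0 _ (hull_face a0 Vy ay)) => v [vV /= av].
  rewrite comb_affE aff_const.
  by have := smin v vV av; lra.
rewrite comb_affE aff_const !fE sE addrAC subrr add0r dotZr.
have d0 : 0 < dot (y - x) (y - x) by apply: dot_gt0; rewrite subr_eq0 eq_sym.
move=> h; have : dot (y - x) (y - x) <= t * dot (y - x) (y - x) by lra.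
rewrite -{1}[dot _ _]mul1r ler_pM2r // => t1'.
have te : t = 1 by lra.
by rewrite te scale1r addrC subrK.
Qed.

(** The step of the simplex method. Let h vanish at w and be positive on the rest of
V. Ratios of functionals vanishing at w to h are constant on rays from w, so
minimising phi / h and then all coordinate ratios leaves a single ray, on which the
point with the largest h is the other end of an edge. *)
Lemma improving_edge V w phi : is_vertex (hull V) w ->
  (exists2 v, v \in V & dot phi (v - w) < 0) ->
  exists s, [/\ w != s, is_vertex (hull V) s, is_edge (hull V) (segment w s)
    & dot phi (s - w) < 0].
Proof.
move=> wv [v1 v1V v1n].
have [h [h0 hE]] := face_aff wv.
have [Vw hw] : hull V w /\ aff h w = 0.
  by have : [set w] w by []; rewrite hE => -[].
pose W := [seq v <- V | v != w].
have WV v : v \in W -> v \in V by rewrite mem_filter => /andP[].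
have hW v : v \in W -> 0 < aff h v.
  rewrite mem_filter => /andP[vw vV]; rewrite lt_neqAle h0 // andbT eq_sym.
  apply: contra vw => /eqP hv; apply/eqP.
  by have : [set w] v by rewrite hE; split=> //; apply: sub_hull.
have v1W : v1 \in W.
  rewrite mem_filter v1V andbT; apply/eqP => e; move: v1n.
  by rewrite e subrr dot0r ltxx.
pose z : 'rV[R]_n * R := (0, 0).
have zE x : aff z x = 0 by rewrite aff_const.
pose f : 'rV[R]_n * R := (phi, - dot phi w).
have fE x : aff f x = dot phi (x - w) by rewrite /aff dotBr.
have z0 v : v \in W -> 0 <= aff z v by rewrite zE.
have [a1 [rho [d [[d0 a1E] a10 [v2 v2W av2] aa1 fmin]]]] := refine f z0 hW v1W (zE v1).
have [a [a0 [v3 v3W av3] aa ca az]] := refine_list (coords w) a10 hW v2W av2.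
have rho0 : rho < 0.
  rewrite -(pmulr_llt0 _ (hW _ v1W)); apply: le_lt_trans (fmin _ v1W (zE _)) _.
  by rewrite fE.
have aw : aff a w = 0.
  apply: az => //; first by rewrite a1E zE fE hw subrr dot0r; ring.
  by move=> g /mapP[i _ ->]; rewrite coords_aff subrr mxE.
have [s] : exists2 s, s \in [seq v <- W | aff a v == 0] &
    forall v, v \in [seq v <- W | aff a v == 0] -> - aff h s <= - aff h v.
  by apply: (@seq_argmin _ _ _ _ v3); rewrite mem_filter av3 eqxx.
rewrite mem_filter => /andP[/eqP as0 sW] smax.
have hs := hW s sW.
have hmax v : v \in W -> aff a v = 0 -> aff h v <= aff h s.
  by move=> vW av; rewrite -lerN2 smax // mem_filter av eqxx.
have aV v : v \in V -> 0 <= aff a v.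
  move=> vV; have [->|vw] := eqVneq v w; first by rewrite aw.
  by apply: a0; rewrite mem_filter vw.
have ws : w != s by move: sW; rewrite mem_filter eq_sym => /andP[].
have FE : segment w s = hull V `&` [set x | aff a x = 0].
  apply/seteqP; split=> x.
    move=> /segmentP[t [t0 t1 ->]]; split=> /=.
      rewrite line_comb; apply: hull_convex => //; rewrite ?subr_ge0 ?subrK //.
      by apply: sub_hull; apply: WV.
    have -> : aff a (w + t *: (s - w)) = (1 - t) * aff a w + t * aff a s.
      by rewrite /aff dotDr dotZr dotBr; ring.
    by rewrite aw as0 !mulr0 addr0.
  move=> [Vx /= ax]; have Zx := hull_face aV Vx ax.
  apply/segmentP; exists (aff h x / aff h s); split.
  - by rewrite divr_ge0 // ?(ltW hs) // (hull_aff_ge0 _ Vx).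
  - rewrite ler_pdivrMr // mul1r -subr_ge0.
    have -> : aff h s - aff h x = aff (comb_aff (0, aff h s) (-1) h) x.
      by rewrite comb_affE aff_const mulN1r.
    apply: (hull_aff_ge0 _ Zx) => v [vV /= av].
    rewrite comb_affE aff_const mulN1r subr_ge0.
    have [->|vw] := eqVneq v w; first by rewrite hw ltW.
    by apply: hmax => //; rewrite mem_filter vw.
  - apply/eqP; rewrite -subr_eq0; apply/eqP/rowP => i.
    pose g := comb_aff (delta_mx 0 i, - w 0 i) (- ((s - w) 0 i / aff h s)) h.
    have -> : (x - (w + aff h x / aff h s *: (s - w))) 0 i = aff g x.
      by rewrite comb_affE coords_aff !mxE; ring.
    rewrite mxE; apply: (hull_aff_eq0 _ Zx) => v [vV /= av].
    rewrite comb_affE coords_aff.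
    have [->|vw] := eqVneq v w; first by rewrite hw mulr0 subrr mxE addr0.
    have vW : v \in W by rewrite mem_filter vw.
    have := ca _ _ _ vW sW (coords_in w i) av as0; rewrite !coords_aff => e.
    by rewrite mulNr mulrAC -e mulfK ?subrr // gt_eqF.
have sF : is_face (hull V) (segment w s) by rewrite FE; apply: hull_is_face.
exists s; split=> //.
- exact: edge_end sF.
- by split=> //; apply: segment_dim1.
- have [_] := aa1 s sW (aa s sW as0); rewrite fE => ->.
  by rewrite nmulr_rlt0.
Qed.

(** Linear programming duality for the slice dot g = 0, l being the Lagrange
multiplier. Points of V on either side of the slice bound l from below and from
above; the bounds are compatible because a segment joining the two sides meets the
slice, where f is at least its minimum. The vertex w minimises g on the face where
the relaxed functional is minimal, and this face contains the point p of the slice. *)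
Lemma slice_min V (f g : 'rV[R]_n) p0 : hull V p0 -> dot g p0 = 0 ->
  exists (l : R) w p, [/\ is_vertex (hull V) w, hull V p /\ dot g p = 0, dot g w <= 0,
        dot f w + l * dot g w = dot f p
      & forall x, hull V x -> dot f p <= dot f x + l * dot g x].
Proof.
move=> Vp0 gp0.
(* Where the segment from a point below the slice to one above it crosses it. *)
pose mid (vw : 'rV[R]_n * 'rV[R]_n) := (dot g vw.2 / (dot g vw.2 - dot g vw.1)) *: vw.1 +
   (- dot g vw.1 / (dot g vw.2 - dot g vw.1)) *: vw.2.
pose C := [seq v <- V | dot g v == 0] ++
  [seq mid (v, w) | v <- [seq v <- V | dot g v < 0], w <- [seq v <- V | 0 < dot g v]].
have Cslice p : p \in C -> hull V p /\ dot g p = 0.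
  rewrite mem_cat => /orP[|/allpairsP[[v w] /= []]].
    by rewrite mem_filter => /andP[/eqP gp pV]; split=> //; apply: sub_hull.
  rewrite !mem_filter => /andP[gv vV] /andP[gw wV] ->.
  have D0 : 0 < dot g w - dot g v by lra.
  have Dn : dot g w - dot g v != 0 by rewrite gt_eqF.
  split.
    apply: hull_convex; try by apply: sub_hull.
    - by apply: divr_ge0; lra.
    - by apply: divr_ge0; lra.
    - by rewrite /= -mulrDl divff.
  by rewrite dotDr !dotZr /=; field.
have [p1 p1C] : exists p, p \in C.
  pose a : 'rV[R]_n * R := (g, 0).
  have aE x : aff a x = dot g x by rewrite /aff addr0.
  have [Vn|] := pselect (exists2 v, v \in V & dot g v < 0); last first.
    move=> nn; have a0 v : v \in V -> 0 <= aff a v.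
      by move=> vV; rewrite aE leNgt; apply/negP => gv; apply: nn; exists v.
    have [|v vV gv] := hull_face_point a0 Vp0; first by rewrite aE.
    by exists v; rewrite mem_cat mem_filter -aE gv eqxx vV.
  have [Vp|] := pselect (exists2 v, v \in V & 0 < dot g v); last first.
    move=> nn; have a0 v : v \in V -> 0 <= aff (opp_aff a) v.
      move=> vV; rewrite opp_affE aE oppr_ge0 leNgt; apply/negP => gv.
      by apply: nn; exists v.
    have [|v vV] := hull_face_point a0 Vp0; first by rewrite opp_affE aE gp0 oppr0.
    rewrite opp_affE => /eqP; rewrite oppr_eq0 aE => gv.
    by exists v; rewrite mem_cat mem_filter gv vV.
  have [v vV gv] := Vn; have [w wV gw] := Vp.
  exists (mid (v, w)); rewrite mem_cat; apply/orP; right.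
  by apply/allpairsP; exists (v, w); rewrite !mem_filter /= gv vV gw wV.
have [p pC pmin] := seq_argmin (dot f) p1C.
have [Vp gp] := Cslice p pC.
pose M := dot f p.
have [l [lL lU]] : exists l,
   (forall k, k \in [seq (M - dot f v) / dot g v | v <- [seq v <- V | 0 < dot g v]] -> k <= l) /\
   (forall k, k \in [seq (M - dot f v) / dot g v | v <- [seq v <- V | dot g v < 0]] -> l <= k).
  apply: seq_gap => _ _ /mapP[w + ->] /mapP[v + ->].
  rewrite !mem_filter => /andP[gw wV] /andP[gv vV].
  have : M <= dot f (mid (v, w)).
    apply: pmin; rewrite mem_cat; apply/orP; right.
    by apply/allpairsP; exists (v, w); rewrite !mem_filter gv vV gw wV.
  have D0 : 0 < dot g w - dot g v by lra.
  rewrite /mid dotDr !dotZr /= ![_ / _ * _]mulrAC -mulrDl ler_pdivlMr // => h.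
  by rewrite ler_pdivrMr // mulrAC ler_ndivlMr //; nra.
have gM v : v \in V -> M <= dot f v + l * dot g v.
  move=> vV; case: (ltgtP (dot g v) 0) => gv.
  - have : l <= (M - dot f v) / dot g v.
      by apply: lU; apply/mapP; exists v; rewrite // mem_filter gv.
    by rewrite ler_ndivlMr //; lra.
  - have : (M - dot f v) / dot g v <= l.
      by apply: lL; apply/mapP; exists v; rewrite // mem_filter gv.
    by rewrite ler_pdivrMr //; lra.
  - rewrite gv mulr0 addr0; apply: pmin.
    by rewrite mem_cat mem_filter gv eqxx vV.
pose a : 'rV[R]_n * R := (f + l *: g, - M).
have aE x : aff a x = dot f x + l * dot g x - M by rewrite /aff /= dotDl dotZl.
have a0 v : v \in V -> 0 <= aff a v by move=> /gM; rewrite aE subr_ge0.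
have ap : aff a p = 0 by rewrite aE gp mulr0 addr0 subrr.
have [v0 v0V av0] := hull_face_point a0 Vp ap.
have [w [wV aw ww wmin]] := exposed_vertex (g, 0) a0 v0V av0.
exists l, w, p; split=> //.
- have := @hull_aff_ge0 _ _ _ (g, - dot g w) p _ (hull_face a0 Vp ap).
  rewrite /aff /= gp add0r oppr_ge0; apply => v [vV /= av].
  by have := wmin v vV av; rewrite /aff /= !addr0 subr_ge0.
- by move: aw; rewrite aE => /eqP; rewrite subr_eq0 => /eqP.
- by move=> x /(hull_aff_ge0 a0); rewrite aE subr_ge0.
Qed.

End Faces.

(** * Lattice bodies with unimodular corners *)

Section Body.
Variable R : realType.
Implicit Types (P : set 'rV[R]_3) (vx : set 'rV[int]_3).

(** What smoothness says at a vertex: the corner is unimodular and its edges have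
integral lengths. *)
Definition frame P vx (w r1 r2 r3 : 'rV[int]_3) : Prop :=
  [/\ vx w, rows3 r1 r2 r3 \in unitmx,
      forall x, P x -> exists a b c : R, [/\ 0 <= a, 0 <= b, 0 <= c
        & x = toR w + (a *: toR r1 + b *: toR r2 + c *: toR r3)]
    & forall r, r \in [:: r1; r2; r3] -> exists2 n : int, 0 < n & vx (w + n *: r)].

(** The convexity facts on which the lattice argument rests; vx is the set of
vertices. In body_slice, p minimises f on the slice dot g = 0 and l is a Lagrange
multiplier, so that the vertex w is on the optimal face of f + l g. *)
Record body P vx : Prop := Body {
  body_convex : forall (x y : 'rV[R]_3) (s t : R), P x -> P y -> 0 <= s -> 0 <= t -> s + t = 1 ->
    P (s *: x + t *: y);
  body_around : exists2 d : R, 0 < d & forall x : 'rV[R]_3, (forall i, `|x 0 i| <= d) -> P x;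
  body_bounded : exists K : R, forall x : 'rV[R]_3, P x -> forall i, `|x 0 i| <= K;
  body_vx : forall w, vx w -> P (toR w);
  body_slice : forall f g : 'rV[R]_3, exists l w p,
    [/\ vx w, P p /\ dot g p = 0, dot g (toR w) <= 0,
        dot f (toR w) + l * dot g (toR w) = dot f p
      & forall x, P x -> dot f p <= dot f x + l * dot g x];
  body_frame : forall w, vx w -> exists r1 r2 r3, frame P vx w r1 r2 r3 }.

Definition pt (p q e : 'rV[int]_3) (x y z : R) : 'rV[R]_3 :=
  x *: toR p + y *: toR q + z *: toR e.

Definition zpt (p q e : 'rV[int]_3) (x y z : int) : 'rV[int]_3 :=
  x *: p + y *: q + z *: e.

Lemma toRD n (a b : 'rV[int]_n) : toR (a + b) = toR a + toR b :> 'rV[R]_n.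
Proof. exact: map_mxD. Qed.

Lemma toRN n (a : 'rV[int]_n) : toR (- a) = - toR a :> 'rV[R]_n.
Proof. exact: map_mxN. Qed.

Lemma toRZ n k (a : 'rV[int]_n) : toR (k *: a) = k%:~R *: toR a :> 'rV[R]_n.
Proof. exact: map_mxZ. Qed.

Lemma toR_zpt p q e x y z : toR (zpt p q e x y z) = pt p q e x%:~R y%:~R z%:~R.
Proof. by rewrite /zpt !toRD !toRZ. Qed.

Lemma pt_def p q e x y z : pt p q e x y z = x *: toR p + y *: toR q + z *: toR e.
Proof. by []. Qed.

Section Lens.
Variables p q e : 'rV[int]_3.
Hypothesis basis : rows3 p q e \in unitmx.
Let B : 'M[R]_3 := map_mx intr (rows3 p q e).
Local Notation pt := (pt p q e).
Local Notation zpt := (zpt p q e).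

Let Bunit : B \in unitmx.
Proof. by rewrite unitmxE det_map_mx rmorph_unit // -unitmxE. Qed.

Let BE : B = rows3 (toR p) (toR q) (toR e).
Proof. by apply/matrixP => i j; rewrite !mxE; do 2 case: ifP => _ //. Qed.

Lemma ptE x y z : pt x y z = row3 x y z *m B.
Proof. by rewrite BE mul_row3. Qed.

Lemma zpt_surj v : exists x y z, v = zpt x y z.
Proof.
have : v = v *m invmx (rows3 p q e) *m rows3 p q e by rewrite mulmxKV.
rewrite [v *m invmx _]row3E mul_row3; set a := (_ *m _) => E.
by exists (a 0 0), (a 0 1), (a 0 2).
Qed.

Lemma pt_surj v : exists x y z, v = pt x y z.
Proof.
have : v = v *m invmx B *m B by rewrite mulmxKV.
by rewrite [v *m invmx _]row3E -ptE => ->; do 3 eexists.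
Qed.

Lemma pt_inj x y z x' y' z' : pt x y z = pt x' y' z' ->
  [/\ x = x', y = y' & z = z'].
Proof.
rewrite !ptE => /(congr1 (mulmx^~ (invmx B))); rewrite !mulmxK //.
by move=> /rowP h; move: (h 0) (h 1) (h 2); rewrite !mxE.
Qed.

Lemma dot_mulmx (v w : 'rV[R]_3) : dot v w = (w *m v^T) 0 0.
Proof. by rewrite mxE; apply: eq_bigr => i _; rewrite mxE mulrC. Qed.

Lemma pt_dot (a b c : R) : exists F, forall x y z,
  dot F (pt x y z) = a * x + b * y + c * z.
Proof.
exists (invmx B *m (row3 a b c)^T)^T => x y z.
rewrite dot_mulmx trmxK ptE mulmxA mulmxK // !mxE big_ord3 !mxE /=.
by rewrite ![x * _]mulrC ![y * _]mulrC ![z * _]mulrC.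
Qed.

Lemma zpt_det x1 y1 z1 x2 y2 z2 x3 y3 z3 :
  rows3 (zpt x1 y1 z1) (zpt x2 y2 z2) (zpt x3 y3 z3) \in unitmx =
  (det3 x1 y1 z1 x2 y2 z2 x3 y3 z3 \is a GRing.unit).
Proof.
have -> : rows3 (zpt x1 y1 z1) (zpt x2 y2 z2) (zpt x3 y3 z3) =
  rows3 (row3 x1 y1 z1) (row3 x2 y2 z2) (row3 x3 y3 z3) *m rows3 p q e.
  apply/matrixP => i j; rewrite !mxE big_ord3 !mxE.
  by move: i; apply: forall_ord3.
rewrite unitmx_mul basis andbT unitmxE det_rows3 !mxE //.
Qed.

Variables (P : set 'rV[R]_3) (vx : set 'rV[int]_3).
Hypothesis bP : body P vx.

Lemma pt_comb x1 y1 z1 x2 y2 z2 s t x y z :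
  P (pt x1 y1 z1) -> P (pt x2 y2 z2) -> 0 <= s -> 0 <= t -> 0 < s + t ->
  (s + t) * x = s * x1 + t * x2 -> (s + t) * y = s * y1 + t * y2 ->
  (s + t) * z = s * z1 + t * z2 -> P (pt x y z).
Proof.
move=> P1 P2 s0 t0 st ex ey ez.
have n0 : s + t != 0 by rewrite gt_eqF.
have -> : pt x y z = (s / (s + t)) *: pt x1 y1 z1 + (t / (s + t)) *: pt x2 y2 z2.
  have xE : x = (s / (s + t)) * x1 + (t / (s + t)) * x2.
    by apply: (mulfI n0); rewrite ex; field.
  have yE : y = (s / (s + t)) * y1 + (t / (s + t)) * y2.
    by apply: (mulfI n0); rewrite ey; field.
  have zE : z = (s / (s + t)) * z1 + (t / (s + t)) * z2.
    by apply: (mulfI n0); rewrite ez; field.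
  rewrite {1}xE {1}yE {1}zE !pt_def; apply/rowP => i; rewrite !mxE; ring.
apply: body_convex bP _ _ _ _ P1 P2 _ _ _.
- by rewrite divr_ge0 // ltW.
- by rewrite divr_ge0 // ltW.
- by rewrite -mulrDl divff.
Qed.

Lemma pt_around : exists2 d, 0 < d & forall x y z,
  `|x| <= d -> `|y| <= d -> `|z| <= d -> P (pt x y z).
Proof.
have [d d0 hd] := body_around bP.
pose S : R := 1 + \sum_i (`|toR p 0 i| + `|toR q 0 i| + `|toR e 0 i|).
have S0 : 0 < S by rewrite ltr_pwDl // sumr_ge0 // => i _; rewrite !addr_ge0.
exists (d / S) => [|x y z hx hy hz]; first by rewrite divr_gt0.
apply: hd => i.
apply: (@le_trans _ _ (d / S * (`|toR p 0 i| + `|toR q 0 i| + `|toR e 0 i|))).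
  rewrite !mxE !mulrDr.
  apply: le_trans (ler_normD _ _) _; apply: lerD; last first.
    by rewrite normrM ler_wpM2r.
  apply: le_trans (ler_normD _ _) _.
  by apply: lerD; rewrite normrM ler_wpM2r.
rewrite -[leRHS](divfK (lt0r_neq0 S0)) ler_wpM2l //; first by rewrite divr_ge0 ?ltW.
rewrite /S (bigD1 i) //= addrCA lerDl addr_ge0 //.
by rewrite sumr_ge0 // => j _; rewrite !addr_ge0.
Qed.

Lemma pt_bounded : exists2 K, 0 < K & forall x y z, P (pt x y z) -> y <= K.
Proof.
have [K hK] := body_bounded bP.
have [F hF] := pt_dot 0 1 0.
exists (1 + \sum_i `|F 0 i| * `|K|) => [|x y z Pp].
  by rewrite ltr_pwDl // sumr_ge0 // => i _; rewrite mulr_ge0.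
have -> : y = dot F (pt x y z) by rewrite hF; ring.
rewrite ler_wpDl //; apply: ler_sum => i _.
apply: le_trans (ler_norm _) _; rewrite normrM ler_wpM2l //.
exact: le_trans (hK _ Pp _) (ler_norm _).
Qed.

Lemma pt_slice (b c : R) : exists (l : R) wx wy wz py pz,
  [/\ vx (zpt wx wy wz), P (pt 0 py pz), wx <= 0,
      b * wy%:~R + c * wz%:~R + l * wx%:~R = b * py + c * pz
    & forall x y z, P (pt x y z) -> b * py + c * pz <= b * y + c * z + l * x].
Proof.
have [f hf] := pt_dot 0 b c; have [g hg] := pt_dot 1 0 0.
have [l [w [v [vw [Pv gv] gw ew hl]]]] := body_slice bP f g.
have [wx [wy [wz wE]]] := zpt_surj w; subst w.
have [px [py [pz vE]]] := pt_surj v; rewrite {}vE in Pv gv ew hl.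
rewrite toR_zpt !hf !hg in gv gw ew hl.
have px0 : px = 0 by lra.
rewrite px0 in Pv ew hl.
exists l, wx, wy, wz, py, pz; split=> //.
- rewrite -(ler_int R); lra.
- lra.
- by move=> x y z Px; have := hl _ Px; rewrite hf hg; lra.
Qed.

Lemma frame_det w x1 y1 z1 x2 y2 z2 x3 y3 z3 :
  frame P vx w (zpt x1 y1 z1) (zpt x2 y2 z2) (zpt x3 y3 z3) ->
  exists d : int, d * det3 x1 y1 z1 x2 y2 z2 x3 y3 z3 = 1.
Proof.
case=> _; rewrite zpt_det => u _ _.
by exists (det3 x1 y1 z1 x2 y2 z2 x3 y3 z3)^-1; rewrite mulVr.
Qed.

Lemma frame_cone wx wy wz x1 y1 z1 x2 y2 z2 x3 y3 z3 :
  frame P vx (zpt wx wy wz) (zpt x1 y1 z1) (zpt x2 y2 z2) (zpt x3 y3 z3) ->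
  forall x y z, P (pt x y z) -> exists a b c : R,
   [/\ 0 <= a, 0 <= b & 0 <= c] /\
   [/\ x = wx%:~R + (a * x1%:~R + b * x2%:~R + c * x3%:~R),
       y = wy%:~R + (a * y1%:~R + b * y2%:~R + c * y3%:~R)
     & z = wz%:~R + (a * z1%:~R + b * z2%:~R + c * z3%:~R)].
Proof.
case=> _ _ h _ x y z /h[a [b [c [a0 b0 c0]]]].
rewrite !toR_zpt => E; exists a, b, c; split; first by [].
apply: pt_inj; rewrite E !pt_def; apply/rowP => i; rewrite !mxE; ring.
Qed.

Lemma pt_vx x y z : vx (zpt x y z) -> P (pt x%:~R y%:~R z%:~R).
Proof. by move/(body_vx bP); rewrite toR_zpt. Qed.

Lemma zptD x y z x' y' z' : zpt x y z + zpt x' y' z' = zpt (x + x') (y + y') (z + z').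
Proof. by apply/rowP => i; rewrite !mxE; ring. Qed.

Lemma zptZ n x y z : n *: zpt x y z = zpt (n * x) (n * y) (n * z).
Proof. by apply/rowP => i; rewrite !mxE; ring. Qed.

Lemma frame_step wx wy wz x1 y1 z1 r2 r3 :
  frame P vx (zpt wx wy wz) (zpt x1 y1 z1) r2 r3 ->
  exists n : int, [/\ 0 < n, vx (zpt (wx + n * x1) (wy + n * y1) (wz + n * z1))
    & P (pt (wx + x1)%:~R (wy + y1)%:~R (wz + z1)%:~R)].
Proof.
case=> vw _ _ /(_ (zpt x1 y1 z1)); rewrite inE eqxx => /(_ isT)[n n0].
rewrite zptZ zptD => vn; exists n; split=> //.
have n1 : (1 : R) <= n%:~R by rewrite (ler_int _ 1) //; lia.
apply: (pt_comb (pt_vx vw) (pt_vx vn) (s := n%:~R - 1) (t := 1)); rewrite ?subr_ge0 // ?intrD ?intrM; try lra; ring.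
Qed.

End Lens.

Lemma rows3_swap (r1 r2 r3 : 'rV[int]_3) :
  rows3 r1 r2 r3 \in unitmx -> rows3 r2 r1 r3 \in unitmx.
Proof.
rewrite !unitmxE !det_rows3 -unitrN; congr (_ \is a _); rewrite /det3; ring.
Qed.

Lemma rows3_rot (r1 r2 r3 : 'rV[int]_3) :
  rows3 r1 r2 r3 \in unitmx -> rows3 r2 r3 r1 \in unitmx.
Proof.
rewrite !unitmxE !det_rows3; congr (_ \is a _); rewrite /det3; ring.
Qed.

Lemma frame_swap P vx w r1 r2 r3 :
  frame P vx w r1 r2 r3 -> frame P vx w r2 r1 r3.
Proof.
case=> vw u h n; split; [by []|exact: rows3_swap| |].
  move=> x /h[a [b [c [a0 b0 c0 ->]]]]; exists b, a, c; split=> //.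
  by rewrite [a *: _ + _]addrC.
by move=> r rin; apply: n; move: rin; rewrite !inE orbCA.
Qed.

Lemma frame_rot P vx w r1 r2 r3 :
  frame P vx w r1 r2 r3 -> frame P vx w r2 r3 r1.
Proof.
case=> vw u h n; split; [by []|exact: rows3_rot| |].
  move=> x /h[a [b [c [a0 b0 c0 ->]]]]; exists b, c, a; split=> //.
  by rewrite -[a *: _ + _ + _]addrA [a *: _ + _]addrC.
by move=> r rin; apply: n; move: rin; rewrite !inE orbA orbC.
Qed.

End Body.

(** * The corner at the other end of an edge *)

Section Coordinates.
Variable R : realType.
Implicit Types (P : set 'rV[R]_3) (vx : set 'rV[int]_3).

Lemma absurd_lt (G : Prop) : (0 : R) < 0 -> G.
Proof. by rewrite ltxx. Qed.

Lemma mul_int_gt0_eq0 (a : R) (x : int) : 0 < a -> a * x%:~R = 0 -> x = 0.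
Proof.
move=> a0 /eqP; rewrite mulf_eq0 (gt_eqF a0) /= intr_eq0 => /eqP //.
Qed.

Lemma sum3_eq0 (a b c : R) (x y z : int) : 0 <= a -> 0 <= b -> 0 <= c ->
  0 <= x -> 0 <= y -> 0 <= z -> a * x%:~R + b * y%:~R + c * z%:~R = 0 ->
  [/\ a * x%:~R = 0, b * y%:~R = 0 & c * z%:~R = 0].
Proof.
move=> a0 b0 c0 x0 y0 z0.
have : 0 <= a * x%:~R by rewrite mulr_ge0 ?ler0z.
have : 0 <= b * y%:~R by rewrite mulr_ge0 ?ler0z.
have : 0 <= c * z%:~R by rewrite mulr_ge0 ?ler0z.
by move=> *; split; lra.
Qed.

Lemma eq0_or_gt0 (a : R) : 0 <= a -> a = 0 \/ 0 < a.
Proof. by rewrite le_eqVlt => /orP[/eqP<-|]; [left|right]. Qed.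

(** Rays with nonzero weight in a combination on the vertical axis must be vertical,
as their first two coordinates are nonnegative; two vertical rays would make the
determinant vanish. *)
Lemma vertical_ray (a b c n : R) (x1 y1 z1 x2 y2 z2 x3 y3 z3 d : int) :
  d * det3 x1 y1 z1 x2 y2 z2 x3 y3 z3 = 1 ->
  0 <= a -> 0 <= b -> 0 <= c -> 0 < n ->
  0 <= x1 -> 0 <= x2 -> 0 <= x3 -> 0 <= y1 -> 0 <= y2 -> 0 <= y3 ->
  a * x1%:~R + b * x2%:~R + c * x3%:~R = 0 ->
  a * y1%:~R + b * y2%:~R + c * y3%:~R = 0 ->
  a * z1%:~R + b * z2%:~R + c * z3%:~R = - n ->
  [\/ [/\ x1 = 0, y1 = 0 & z1 = -1], [/\ x2 = 0, y2 = 0 & z2 = -1]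
    | [/\ x3 = 0, y3 = 0 & z3 = -1]].
Proof.
move=> D a0 b0 c0 n0 hx1 hx2 hx3 hy1 hy2 hy3 ex ey ez.
have [ax bx cx] := sum3_eq0 a0 b0 c0 hx1 hx2 hx3 ex.
have [ay by_ cy] := sum3_eq0 a0 b0 c0 hy1 hy2 hy3 ey.
have unit_neg (k z : int) (t : R) : 0 < t -> t * z%:~R = - n -> z * k = 1 -> z = -1.
  move=> t0 tz zk.
  have zn : z < 0 by rewrite -(ltr_int R) -(pmulr_rlt0 _ t0) tz oppr_lt0.
  have k0 : k < 0 by nia.
  by nia.
have [a0'|ap] := eq0_or_gt0 a0.
  subst a.
  have [b0'|bp] := eq0_or_gt0 b0.
    subst b.
    have [c0'|cp] := eq0_or_gt0 c0; first by subst c; apply: absurd_lt; lra.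
    have x30 := mul_int_gt0_eq0 cp cx; have y30 := mul_int_gt0_eq0 cp cy.
    apply: Or33; split=> //; subst x3 y3.
    apply: (@unit_neg (d * (x1 * y2 - y1 * x2)) _ c) => //; first by lra.
    by rewrite -D /det3; ring.
  have x20 := mul_int_gt0_eq0 bp bx; have y20 := mul_int_gt0_eq0 bp by_.
  have [c0'|cp] := eq0_or_gt0 c0; last first.
    have x30 := mul_int_gt0_eq0 cp cx; have y30 := mul_int_gt0_eq0 cp cy.
    by move: D; subst x2 y2 x3 y3; rewrite /det3; lia.
  subst c; apply: Or32; split=> //; subst x2 y2.
  apply: (@unit_neg (d * (x3 * y1 - y3 * x1)) _ b) => //; first by lra.
  by rewrite -D /det3; ring.
have x10 := mul_int_gt0_eq0 ap ax; have y10 := mul_int_gt0_eq0 ap ay.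
have [b0'|bp] := eq0_or_gt0 b0; last first.
  have x20 := mul_int_gt0_eq0 bp bx; have y20 := mul_int_gt0_eq0 bp by_.
  by move: D; subst x1 y1 x2 y2; rewrite /det3; lia.
have [c0'|cp] := eq0_or_gt0 c0; last first.
  have x30 := mul_int_gt0_eq0 cp cx; have y30 := mul_int_gt0_eq0 cp cy.
  by move: D; subst x1 y1 x3 y3; rewrite /det3; lia.
subst b c; apply: Or31; split=> //; subst x1 y1.
apply: (@unit_neg (d * (x2 * y3 - y2 * x3)) _ a) => //; first by lra.
by rewrite -D /det3; ring.
Qed.

Lemma unit_factors (d x y : int) : d * (x * y) = 1 -> 0 <= x -> 0 <= y ->
  x = 1 /\ y = 1.
Proof.
move=> D x0 y0.
have xp : 0 < x by move: D; case: (ltgtP 0 x) x0 => // <-; lia.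
have yp : 0 < y by move: D; case: (ltgtP 0 y) y0 => // <-; lia.
have xy : 0 < x * y by rewrite mulr_gt0.
have dp : 0 < d by rewrite -(pmulr_lgt0 _ xy) D.
have : x * y <= 1 by nia.
by split; nia.
Qed.

(** A cone in the quadrant that contains both axes is the quadrant, and its primitive
generators are the unit vectors. *)
Lemma quadrant_rays (k1 k2 n1 n2 : R) (x1 y1 x2 y2 d : int) :
  d * (x1 * y2 - y1 * x2) = 1 ->
  0 <= x1 -> 0 <= x2 -> 0 <= y1 -> 0 <= y2 ->
  0 <= k1 -> 0 <= k2 -> 0 <= n1 -> 0 <= n2 ->
  k1 * x1%:~R + k2 * x2%:~R = 1 -> k1 * y1%:~R + k2 * y2%:~R = 0 ->
  n1 * x1%:~R + n2 * x2%:~R = 0 -> n1 * y1%:~R + n2 * y2%:~R = 1 ->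
  [/\ x1 = 1, y1 = 0, x2 = 0 & y2 = 1] \/ [/\ x1 = 0, y1 = 1, x2 = 1 & y2 = 0].
Proof.
move=> D x10 x20 y10 y20 k10 k20 n10 n20 kx ky nx ny.
have [ky1 ky2 _] : [/\ k1 * y1%:~R = 0, k2 * y2%:~R = 0 & 0 * 0%:~R = 0 :> R].
  by apply: sum3_eq0; rewrite // mul0r addr0.
have [nx1 nx2 _] : [/\ n1 * x1%:~R = 0, n2 * x2%:~R = 0 & 0 * 0%:~R = 0 :> R].
  by apply: sum3_eq0; rewrite // mul0r addr0.
have [k1z|k1p] := eq0_or_gt0 k10.
  have [k2z|k2p] := eq0_or_gt0 k20; first by subst k1 k2; apply: absurd_lt; lra.
  have y2z := mul_int_gt0_eq0 k2p ky2; subst y2; right.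
  have [x2e y1e] : x2 = 1 /\ y1 = 1.
    by apply: (@unit_factors (- d)) => //; rewrite -D; ring.
  subst x2 y1; split=> //.
  have [n1z|n1p] := eq0_or_gt0 n10; first by subst n1; apply: absurd_lt; lra.
  exact: mul_int_gt0_eq0 n1p nx1.
have y1z := mul_int_gt0_eq0 k1p ky1; subst y1; left.
have [x1e y2e] : x1 = 1 /\ y2 = 1.
  by apply: (@unit_factors d) => //; rewrite -D; ring.
subst x1 y2; split=> //.
have [n2z|n2p] := eq0_or_gt0 n20; first by subst n2; apply: absurd_lt; lra.
exact: mul_int_gt0_eq0 n2p nx2.
Qed.

Lemma zpt100 p q e : p = zpt p q e 1 0 0.
Proof. by rewrite /zpt scale1r !scale0r !addr0. Qed.
Lemma zpt010 p q e : q = zpt p q e 0 1 0.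
Proof. by rewrite /zpt scale1r !scale0r addr0 add0r. Qed.
Lemma zpt001 p q e : e = zpt p q e 0 0 1.
Proof. by rewrite /zpt scale1r !scale0r !add0r. Qed.

Lemma frame_basis P vx w r1 r2 r3 : frame P vx w r1 r2 r3 -> rows3 r1 r2 r3 \in unitmx.
Proof. by case. Qed.

Lemma frame_vx P vx w r1 r2 r3 : frame P vx w r1 r2 r3 -> vx w.
Proof. by case. Qed.

Lemma corner_ge P vx p q e ux uy uz x y z :
  frame P vx (zpt p q e ux uy uz) p q e -> P (pt p q e x y z) ->
  [/\ ux%:~R <= x, uy%:~R <= y & uz%:~R <= z].
Proof.
move=> tu Px; have bs := frame_basis tu.
move: (tu); rewrite {2}(zpt100 p q e) {3}(zpt010 p q e) {4}(zpt001 p q e).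
move=> /(frame_cone bs)/(_ _ _ _ Px)[a [b [c [[a0 b0 c0] [-> -> ->]]]]].
by split; lra.
Qed.

Section Flip.
Variables (P : set 'rV[R]_3) (vx : set 'rV[int]_3).
Hypothesis bP : body P vx.

Lemma frame_end u p q e : frame P vx u p q e -> P (toR (u + p)).
Proof.
move=> tu; have bs := frame_basis tu.
have [ux [uy [uz uE]]] := zpt_surj bs u; subst u.
move: (tu); rewrite {2}(zpt100 p q e) => /(frame_step bP)[n [_ _]].
by rewrite {3}(zpt100 p q e) zptD toR_zpt !intrD.
Qed.

(** At the other end v of the edge in direction e, one ray points back along the edge.
Modulo e the other two generate a cone inside the one of p and q, because P is in
the corner at u, and it contains p and q, because u + p and u + q are in P. So the
rays at v are p, q up to multiples of e, and - e. *)
Lemma edge_flip u p q e : frame P vx u p q e -> exists n c d : int,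
  0 < n /\ frame P vx (u + n *: e) (p + c *: e) (q + d *: e) (- e).
Proof.
move=> tu; have bs := frame_basis tu.
have [ux [uy [uz uE]]] := zpt_surj bs u; subst u.
have Pu : P (pt p q e ux%:~R uy%:~R uz%:~R) by apply: (pt_vx bP); case: tu.
have Pup : P (pt p q e (ux%:~R + 1) uy%:~R uz%:~R).
  have := frame_end tu; rewrite {2}(zpt100 p q e) zptD toR_zpt !intrD.
  by rewrite !addr0.
have Puq : P (pt p q e ux%:~R (uy%:~R + 1) uz%:~R).
  have := frame_end (frame_swap tu).
  rewrite {2}(zpt010 p q e) zptD toR_zpt !intrD.
  by rewrite !addr0.
have [n n0 vn] : exists2 n : int, 0 < n & vx (zpt p q e ux uy uz + n *: e).
  by case: tu => _ _ _; apply; rewrite !inE eqxx !orbT.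
have vE : zpt p q e ux uy uz + n *: e = zpt p q e ux uy (uz + n).
  by rewrite {2}(zpt001 p q e) zptZ zptD; congr zpt; ring.
rewrite vE in vn; exists n; rewrite vE.
have [r1 [r2 [r3 tv]]] := body_frame bP vn.
have nR : (0 : R) < n%:~R by rewrite ltr0z.
have nonneg r1' r2' r3' x y z : r1' = zpt p q e x y z ->
    frame P vx (zpt p q e ux uy (uz + n)) r1' r2' r3' -> 0 <= x /\ 0 <= y.
  move=> -> /(frame_step bP)[k [_ _ /(corner_ge tu)[]]].
  by rewrite !ler_int => *; split; lia.
have last_down s1 s2 s3 : frame P vx (zpt p q e ux uy (uz + n)) s1 s2 s3 ->
    s3 = - e -> exists c d, frame P vx (zpt p q e ux uy (uz + n)) (p + c *: e) (q + d *: e) (- e).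
  move=> ts s3E; rewrite s3E in ts.
  have [x1 [y1 [z1 s1E]]] := zpt_surj bs s1.
  have [x2 [y2 [z2 s2E]]] := zpt_surj bs s2.
  have [x10 y10] := nonneg _ _ _ _ _ _ s1E ts.
  have [x20 y20] := nonneg _ _ _ _ _ _ s2E (frame_swap ts).
  have eE : - e = zpt p q e 0 0 (-1) by rewrite /zpt !scale0r !add0r scaleN1r.
  rewrite s1E s2E eE in ts.
  have [d D] := frame_det bs ts.
  have [k1 [k2 [k3 [[k10 k20 _] [kx ky _]]]]] := frame_cone bs ts Pup.
  have [n1 [n2 [n3 [[n10 n20 _] [nx ny _]]]]] := frame_cone bs ts Puq.
  have D' : (- d) * (x1 * y2 - y1 * x2) = 1 by rewrite -D /det3; ring.
  have := @quadrant_rays k1 k2 n1 n2 _ _ _ _ _ D' x10 x20 y10 y20 k10 k20 n10 n20.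
  case; [lra|lra|lra|lra| |].
    case=> ? ? ? ?; subst x1 y1 x2 y2; exists z1, z2; rewrite eE.
    have -> : p + z1 *: e = zpt p q e 1 0 z1 by rewrite /zpt scale1r scale0r addr0.
    by have -> : q + z2 *: e = zpt p q e 0 1 z2 by rewrite /zpt scale1r scale0r add0r.
  case=> ? ? ? ?; subst x1 y1 x2 y2; exists z2, z1; rewrite eE.
  have -> : p + z2 *: e = zpt p q e 1 0 z2 by rewrite /zpt scale1r scale0r addr0.
  have -> : q + z1 *: e = zpt p q e 0 1 z1 by rewrite /zpt scale1r scale0r add0r.
  exact: frame_swap.
have [x1 [y1 [z1 r1E]]] := zpt_surj bs r1.
have [x2 [y2 [z2 r2E]]] := zpt_surj bs r2.
have [x3 [y3 [z3 r3E]]] := zpt_surj bs r3.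
have [x10 y10] := nonneg _ _ _ _ _ _ r1E tv.
have [x20 y20] := nonneg _ _ _ _ _ _ r2E (frame_rot tv).
have [x30 y30] := nonneg _ _ _ _ _ _ r3E (frame_rot (frame_rot tv)).
have downE z : z = -1 -> zpt p q e 0 0 z = - e.
  by move=> ->; rewrite /zpt !scale0r !add0r scaleN1r.
move: (tv); rewrite r1E r2E r3E => tv'.
have [d D] := frame_det bs tv'.
have [a [b [c [[a0 b0 c0] [ex ey ez]]]]] := frame_cone bs tv' Pu.
have := vertical_ray D a0 b0 c0 nR x10 x20 x30 y10 y20 y30.
case; [lra|lra|by rewrite intrD in ez; lra| | |] => -[ex' ey' ez'].
- have [|k [l t]] := last_down _ _ _ (frame_rot tv).
    by rewrite r1E ex' ey' downE.
  by exists k, l.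
- have [|k [l t]] := last_down _ _ _ (frame_rot (frame_rot tv)).
    by rewrite r2E ex' ey' downE.
  by exists k, l.
- have [|k [l t]] := last_down _ _ _ tv.
    by rewrite r3E ex' ey' downE.
  by exists k, l.
Qed.

End Flip.
End Coordinates.

(** * Lattice points on the axis *)

Section Low.
Variable R : realType.
Variables (P : set 'rV[R]_3) (vx : set 'rV[int]_3).
Hypothesis bP : body P vx.

Section Corner.
Variables (u p q e : 'rV[int]_3) (a : int).
Hypothesis tu : frame P vx u p q e.
Hypothesis uE : u = zpt p q e (-1) (-1) a.
Let bs := frame_basis tu.
Local Notation Q := (fun x y z : R => P (pt p q e x y z)).

Lemma corner_lower x y z : Q x y z -> [/\ -1 <= x, -1 <= y & a%:~R <= z].
Proof. by move: tu; rewrite uE => t /(corner_ge t). Qed.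

Lemma corner_level_lt0 : a <= -1.
Proof.
have [d d0 hd] := pt_around p q e bP.
have Qd : Q 0 0 (- d) by apply: hd; rewrite ?normr0 ?normrN ?(gtr0_norm d0) ?(ltW d0).
have [_ _ ad] := corner_lower Qd.
have : (a%:~R : R) < 0 by lra.
by rewrite (ltr_int R a 0) => ?; lia.
Qed.

Lemma corner_pt : Q (-1) (-1) a%:~R.
Proof.
have := frame_vx tu; rewrite uE => /(pt_vx bP).
by rewrite !intrN.
Qed.

Lemma corner_p : Q 0 (-1) a%:~R.
Proof.
have := frame_end bP tu; rewrite uE {2}(zpt100 p q e) zptD toR_zpt.
by rewrite !addr0 addNr.
Qed.

Lemma corner_q : Q (-1) 0 a%:~R.
Proof.
have := frame_end bP (frame_swap tu); rewrite uE {2}(zpt010 p q e) zptD toR_zpt.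
by rewrite !addr0 addNr.
Qed.

Lemma corner_e : Q (-1) (-1) (a%:~R + 1).
Proof.
have := frame_end bP (frame_rot (frame_rot tu)).
rewrite uE {2}(zpt001 p q e) zptD toR_zpt.
by rewrite !addr0 intrD.
Qed.

Lemma origin_in : Q 0 0 0.
Proof.
by have [d d0 hd] := pt_around p q e bP; apply: hd; rewrite normr0 ltW.
Qed.

Lemma lower_axis z : Q 0 0 z -> z <= -1 -> Q 0 0 (-1).
Proof.
move=> Qz z1; apply: (pt_comb bP origin_in Qz (s := - z - 1) (t := 1)); lra.
Qed.

End Corner.

Section Neighbour.
Variables (u p q e : 'rV[int]_3) (a : int).
Hypothesis tu : frame P vx u p q e.
Hypothesis uE : u = zpt p q e (-1) (-1) a.
Let bs := frame_basis tu.
Local Notation Q := (fun x y z : R => P (pt p q e x y z)).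

(** Here n is the length of the edge from u along p, and q + g p, e + s p are the
other two rays at its end. For n = 1 and g = -1 the facet z = a is the unimodular
triangle on u, u + p, u + q, and the last inequality is that of the facet across
its third side. *)
Lemma square_or_triangle : exists n g s : int, [/\ 0 < n,
  Q (n%:~R - 1) (-1) a%:~R,
  (n = 1 -> Q g%:~R 0 a%:~R) &
  (n = 1 -> g = -1 -> [/\ Q s%:~R (-1) (a%:~R + 1), 1 < - s%:~R * a%:~R :> R
     & forall x y z, Q x y z -> x + y + 1 <= s%:~R * (z - a%:~R)])].
Proof.
have [n [g [s [n0 tw]]]] := edge_flip bP (frame_rot tu).
exists n, g, s.
have wE : u + n *: p = zpt p q e (n - 1) (-1) a.
  by rewrite uE {2}(zpt100 p q e) zptZ zptD; congr zpt; ring.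
have qE : q + g *: p = zpt p q e g 1 0.
  by rewrite {1}(zpt010 p q e) {2}(zpt100 p q e) zptZ zptD; congr zpt; ring.
have eE : e + s *: p = zpt p q e s 0 1.
  by rewrite {1}(zpt001 p q e) {2}(zpt100 p q e) zptZ zptD; congr zpt; ring.
have pE : - p = zpt p q e (-1) 0 0.
  by rewrite {1}(zpt100 p q e) -scaleN1r zptZ; congr zpt; ring.
rewrite wE qE eE pE in tw.
split=> //.
- by have := pt_vx bP (frame_vx tw); rewrite intrB intrN.
- move=> n1; have [_ [_ _]] := frame_step bP tw.
  by rewrite n1 subrr add0r addNr addr0.
- move=> n1 g1; rewrite n1 g1 subrr in tw.
  have cone x y z : Q x y z -> x + y + 1 <= s%:~R * (z - a%:~R).
    move=> /(frame_cone bs tw)[b [c [d [[b0 c0 d0] [-> -> ->]]]]].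
    nra.
  split=> //.
    have [_ [_ _]] := frame_step bP (frame_rot tw).
    by rewrite add0r addr0 intrD.
  have [d d0 hd] := pt_around p q e bP.
  have Qd : Q d 0 0 by apply: hd; rewrite ?normr0 ?(gtr0_norm d0) ?(ltW d0).
  by have := cone _ _ _ Qd; lra.
Qed.

End Neighbour.

Section Depth.
Variables (u p q e : 'rV[int]_3) (a : int).
Hypothesis tu : frame P vx u p q e.
Hypothesis uE : u = zpt p q e (-1) (-1) a.
Let bs := frame_basis tu.
Local Notation Q := (fun x y z : R => P (pt p q e x y z)).

Lemma zpt_swap (p' q' e' : 'rV[int]_3) x y z : zpt q' p' e' x y z = zpt p' q' e' y x z.
Proof. by rewrite /zpt [x *: _ + _]addrC. Qed.

Lemma pt_swap (p' q' e' : 'rV[int]_3) (x y z : R) : pt q' p' e' x y z = pt p' q' e' y x z.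
Proof. by rewrite /pt [x *: _ + _]addrC. Qed.

(** When both edges in the facet z = a have length at least 2, or one of them has
length 1 and does not close a triangle, the point (0, 0, a) is in the facet.
Otherwise the facet is a triangle, and the facet across its third side opens
outwards with slope s, because the origin is inside P: s a < -1. So the layer
z = a + 1 contains the triangle with vertices (-1, -1), (s, -1), (-1, s'), which
contains (0, 0), and also (1, 0) and (-1, 0) when a = -1, as then s, s' >= 2. *)
Lemma axis_depth : Q 0 0 (-1) \/ [/\ a = -1, Q 1 0 0 & Q (-1) 0 0].
Proof.
have a1 := corner_level_lt0 tu uE.
have aR : (a%:~R : R) <= -1 by rewrite (ler_int _ _ (-1)).
have low := @lower_axis p q e.
have comb x1 y1 z1 x2 y2 z2 s t x y z := @pt_comb R p q e P vx bP x1 y1 z1 x2 y2 z2 s t x y z.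
have hp := corner_p tu uE. have hq := corner_q tu uE. have he := corner_e tu uE.
have uE' : u = zpt q p e (-1) (-1) a by rewrite zpt_swap.
have [n [g [s [n0 Pn Pg Ps]]]] := square_or_triangle tu uE.
have [n' [g' [s' [n0' Pn' Pg' Ps']]]] := square_or_triangle (frame_swap tu) uE'.
rewrite pt_swap in Pn'.
have floor_in : Q 0 0 a%:~R -> Q 0 0 (-1) by move/low; apply.
have gE : n = 1 -> Q 0 0 (-1) \/ g = -1.
  move=> n1; have Qg := Pg n1; have [+ _ _] := corner_lower tu uE Qg.
  rewrite (ler_int R (-1)) => g1.
  have [g0|g0] := lerP 0 g; [left|by right; lia].
  have gR : (0 : R) <= g%:~R by rewrite ler0z.
  by apply: floor_in; apply: (comb _ _ _ _ _ _ 1 g%:~R _ _ _ Qg hq); lra.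
have gE' : n' = 1 -> Q 0 0 (-1) \/ g' = -1.
  move=> n1; have Qg := Pg' n1; rewrite pt_swap in Qg.
  have [_ + _] := corner_lower tu uE Qg.
  rewrite (ler_int R (-1)) => g1.
  have [g0|g0] := lerP 0 g'; [left|by right; lia].
  have gR : (0 : R) <= g'%:~R by rewrite ler0z.
  by apply: floor_in; apply: (comb _ _ _ _ _ _ 1 g'%:~R _ _ _ Qg hp); lra.
have [n1|n2] : n = 1 \/ 2 <= n by lia.
  have [|g1] := gE n1; first by left.
  have [Qs sa cone] := Ps n1 g1.
  have n1' : n' = 1.
    have := cone _ _ _ Pn'; rewrite subrr mulr0 => h.
    have : (n'%:~R : R) <= 1 by lra.
    rewrite (ler_int R _ 1); lia.
  have [|g1'] := gE' n1'; first by left.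
  have [Qs' sa' _] := Ps' n1' g1'; rewrite pt_swap in Qs'.
  have : (1%:~R : R) < (- s * a)%:~R by rewrite intrM intrN.
  have : (1%:~R : R) < (- s' * a)%:~R by rewrite intrM intrN.
  rewrite !ltr_int => sa1' sa1.
  have [a2|a2] : a = -1 \/ a <= -2 by lia.
    have s2 : (2 : R) <= s%:~R by rewrite (ler_int R 2); nia.
    have s2' : (2 : R) <= s'%:~R by rewrite (ler_int R 2); nia.
    rewrite a2 in he Qs Qs'; right; split=> //.
      have Q1 : Q 2 (-1) 0.
        by apply: (comb _ _ _ _ _ _ (s%:~R - 2) 3 _ _ _ he Qs); lra.
      have Q2 : Q (-1) 2 0.
        by apply: (comb _ _ _ _ _ _ (s'%:~R - 2) 3 _ _ _ he Qs'); lra.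
      by apply: (comb _ _ _ _ _ _ 2 1 _ _ _ Q1 Q2); lra.
    by apply: (comb _ _ _ _ _ _ s'%:~R 1 _ _ _ he Qs'); lra.
  have s1 : (1 : R) <= s%:~R by rewrite (ler_int R 1); nia.
  have s1' : (1 : R) <= s'%:~R by rewrite (ler_int R 1); nia.
  have Q1 : Q 1 (-1) (a%:~R + 1).
    by apply: (comb _ _ _ _ _ _ (s%:~R - 1) 2 _ _ _ he Qs); lra.
  have Q2 : Q (-1) 1 (a%:~R + 1).
    by apply: (comb _ _ _ _ _ _ (s'%:~R - 1) 2 _ _ _ he Qs'); lra.
  have aR2 : (a%:~R : R) <= -2 by rewrite (ler_int _ _ (-2)).
  left; apply: (low (a%:~R + 1)); last by lra.
  by apply: (comb _ _ _ _ _ _ 1 1 _ _ _ Q1 Q2); lra.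
left.
have [n1'|n2'] : n' = 1 \/ 2 <= n' by lia.
  have [//|g1'] := gE' n1'.
  have [_ _ cone] := Ps' n1' g1'; exfalso.
  rewrite -pt_swap in Pn.
  have := cone _ _ _ Pn; rewrite subrr mulr0 => h.
  have : (n%:~R : R) <= 1 by lra.
  rewrite (ler_int R _ 1); lia.
have nR : (2 : R) <= n%:~R by rewrite (ler_int R 2).
have nR' : (2 : R) <= n'%:~R by rewrite (ler_int R 2).
have hu := corner_pt tu uE.
have Q1 : Q 1 (-1) a%:~R.
  by apply: (comb _ _ _ _ _ _ (n%:~R - 2) 2 _ _ _ hu Pn); lra.
have Q2 : Q (-1) 1 a%:~R.
  by apply: (comb _ _ _ _ _ _ (n'%:~R - 2) 2 _ _ _ hu Pn'); lra.
by apply: floor_in; apply: (comb _ _ _ _ _ _ 1 1 _ _ _ Q1 Q2); lra.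
Qed.

End Depth.
End Low.

(** * The slice x = 0 is a lattice polygon *)

Section Slice.
Variable R : realType.
Variables (P : set 'rV[R]_3) (vx : set 'rV[int]_3).
Hypothesis bP : body P vx.
Variables (u p q e : 'rV[int]_3) (a : int).
Hypothesis tu : frame P vx u p q e.
Hypothesis uE : u = zpt p q e (-1) (-1) a.
Let bs := frame_basis tu.
Local Notation Q := (fun x y z : R => P (pt p q e x y z)).
Local Notation zp := (zpt p q e).

Lemma row_x_ge0 wy wz x1 y1 z1 r2 r3 :
  frame P vx (zp (-1) wy wz) (zp x1 y1 z1) r2 r3 -> 0 <= x1.
Proof.
move=> /(frame_step bP)[_ [_ _ /(corner_lower tu uE)[+ _ _]]].
by rewrite (ler_int R (-1)); lia.
Qed.

(** The facet x = -1 contains u, u + q and u + e, so its cone at any vertex has two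
rays in the facet. *)
Lemma facet_row wy wz x1 y1 z1 x2 y2 z2 x3 y3 z3 :
  frame P vx (zp (-1) wy wz) (zp x1 y1 z1) (zp x2 y2 z2) (zp x3 y3 z3) ->
  0 < x1 -> x2 = 0.
Proof.
move=> tw x10.
have x20 := row_x_ge0 (frame_rot tw).
have x30 := row_x_ge0 (frame_rot (frame_rot tw)).
case: (ltgtP 0 x2) x20 => // x2p _.
have flat y z : Q (-1) y z -> exists t : R,
    y = wy%:~R + t * y3%:~R /\ z = wz%:~R + t * z3%:~R.
  move=> /(frame_cone bs tw)[b [c [d [[b0 c0 d0] [ex ey ez]]]]].
  have [bx cx _] : [/\ b * x1%:~R = 0, c * x2%:~R = 0 & d * x3%:~R = 0].
    by apply: sum3_eq0 => //; [exact: ltW|exact: ltW|lra].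
  have bz : b = 0.
    by move/eqP: bx; rewrite mulf_eq0 intr_eq0 (gt_eqF x10) orbF => /eqP.
  have cz : c = 0.
    by move/eqP: cx; rewrite mulf_eq0 intr_eq0 (gt_eqF x2p) orbF => /eqP.
  by exists d; rewrite ey ez bz cz; split; ring.
have [t0 [ty0 tz0]] := flat _ _ (corner_pt bP tu uE).
have [t1 [ty1 tz1]] := flat _ _ (corner_q bP tu uE).
have [t2 [ty2 tz2]] := flat _ _ (corner_e bP tu uE).
have hy : (t1 - t0) * y3%:~R = 1 by lra.
have hz : (t1 - t0) * z3%:~R = 0 by lra.
have hz2 : (t2 - t0) * z3%:~R = 1 by lra.
have z30 : z3%:~R = 0 :> R.
  move/eqP: hz; rewrite mulf_eq0 => /orP[/eqP h|/eqP //].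
  by move: hy; rewrite h mul0r => /eqP; rewrite eq_sym oner_eq0.
by move: hz2; rewrite z30 mulr0 => /eqP; rewrite eq_sym oner_eq0.
Qed.

(** A vertex of the slice x = 0 is a vertex of P, or the first lattice point on an
edge that leaves the facet x = -1. *)
Definition slice_vertex cy cz : Prop := vx (zp 0 cy cz) \/
  exists wy wz y1 z1 y2 z2 y3 z3 : int,
    [/\ frame P vx (zp (-1) wy wz) (zp 1 y1 z1) (zp 0 y2 z2) (zp 0 y3 z3),
        cy = wy + y1 & cz = wz + z1].

(** The slice x = 0 is a lattice polygon: by duality some vertex w of P with x <= 0 is
on the optimal face of a relaxed functional. If w is on the facet x = -1, that face
also contains a point of the slice, hence the only ray at w along which x increases;
unimodularity makes x increase by 1 on it, so that it enters the slice at a lattice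
point. *)
Lemma slice_vertexP (b c : R) : exists cy cz : int,
  [/\ slice_vertex cy cz, Q 0 cy%:~R cz%:~R
    & forall y z, Q 0 y z -> b * cy%:~R + c * cz%:~R <= b * y + c * z].
Proof.
have [l [wx [wy [wz [py [pz [vw Qp wx0 ew hmin]]]]]]] := pt_slice bs bP b c.
have hslice y z : Q 0 y z -> b * py + c * pz <= b * y + c * z.
  by move=> /hmin; rewrite mulr0 addr0.
have [wx1 _ _] := corner_lower tu uE (pt_vx bP vw).
have : (-1 <= wx)%R by rewrite -(ler_int R).
move=> {}wx1.
have [wxE|wxE] : wx = 0 \/ wx = -1 by lia.
  subst wx; exists wy, wz; split; [by left|exact: (pt_vx bP vw)|].
  move=> y z /hslice; rewrite -ew mulr0 addr0; exact.
subst wx.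
have aux x1 y1 z1 x2 y2 z2 x3 y3 z3 (k1 k2 k3 : R) :
    frame P vx (zp (-1) wy wz) (zp x1 y1 z1) (zp x2 y2 z2) (zp x3 y3 z3) ->
    0 <= k1 -> 0 <= k2 -> 0 <= k3 ->
    py = wy%:~R + (k1 * y1%:~R + k2 * y2%:~R + k3 * y3%:~R) ->
    pz = wz%:~R + (k1 * z1%:~R + k2 * z2%:~R + k3 * z3%:~R) ->
    1 = k1 * x1%:~R + k2 * x2%:~R + k3 * x3%:~R ->
    0 < k1 * x1%:~R ->
  exists cy cz : int,
  [/\ slice_vertex cy cz, Q 0 cy%:~R cz%:~R
    & forall y z, Q 0 y z -> b * cy%:~R + c * cz%:~R <= b * y + c * z].
  move=> tw k10 k20 k30 yE zE xE pos.
  have x10 : 0 < x1.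
    have := row_x_ge0 tw; rewrite le_eqVlt => /orP[/eqP x10|//].
    by move: pos; rewrite -x10 mulr0z mulr0 !ltxx.
  have x1R : (0 : R) < x1%:~R by rewrite ltr0z.
  have k1p : 0 < k1 by rewrite -(pmulr_lgt0 _ x1R).
  have x2E := facet_row tw x10.
  have x3E := facet_row (frame_rot (frame_swap tw)) x10.
  subst x2 x3.
  have x1E : x1 = 1.
    have [d D] := frame_det bs tw.
    have D' : (d * (y2 * z3 - z2 * y3)) * (x1 * 1) = 1 by rewrite -[RHS]D /det3; ring.
    by have [] := unit_factors D' (ltW x10) ler01.
  subst x1.
  have g_ge0 x y z r2 r3 : frame P vx (zp (-1) wy wz) (zp x y z) r2 r3 ->
      0 <= b * y%:~R + c * z%:~R + l * x%:~R.
    move=> /(frame_step bP)[_ [_ _ /hmin]]; rewrite !intrD; lra.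
  have g1 := g_ge0 _ _ _ _ _ tw.
  have g2 := g_ge0 _ _ _ _ _ (frame_rot tw).
  have g3 := g_ge0 _ _ _ _ _ (frame_rot (frame_rot tw)).
  have g10 : k1 * (b * y1%:~R + c * z1%:~R + l * 1%:~R) = 0.
    have h1 := mulr_ge0 k10 g1; have h2 := mulr_ge0 k20 g2.
    have h3 := mulr_ge0 k30 g3.
    have sum0 : k1 * (b * y1%:~R + c * z1%:~R + l * 1%:~R) +
      k2 * (b * y2%:~R + c * z2%:~R + l * 0%:~R) +
      k3 * (b * y3%:~R + c * z3%:~R + l * 0%:~R) = 0.
      transitivity (b * (py - wy%:~R) + c * (pz - wz%:~R) +
        l * (k1 * 1%:~R + k2 * 0%:~R + k3 * 0%:~R)).
        by rewrite yE zE; ring.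
      by rewrite -xE; lra.
    lra.
  have {}g10 : b * y1%:~R + c * z1%:~R + l = 0.
    by move/eqP: g10; rewrite mulf_eq0 (gt_eqF k1p) mulr1 => /eqP.
  exists (wy + y1), (wz + z1); split.
  - by right; exists wy, wz, y1, z1, y2, z2, y3, z3.
  - by have [_ [_ _]] := frame_step bP tw; rewrite addNr.
  - by move=> y z /hslice; rewrite !intrD; lra.
have [r1 [r2 [r3 tw]]] := body_frame bP vw.
have [x1 [y1 [z1 r1E]]] := zpt_surj bs r1.
have [x2 [y2 [z2 r2E]]] := zpt_surj bs r2.
have [x3 [y3 [z3 r3E]]] := zpt_surj bs r3.
rewrite r1E r2E r3E in tw.
have [k1 [k2 [k3 [[k10 k20 k30] [xE yE zE]]]]] := frame_cone bs tw Qp.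
have {}xE : 1 = k1 * x1%:~R + k2 * x2%:~R + k3 * x3%:~R by lra.
have [h1|h1] := ltrP 0 (k1 * x1%:~R).
  exact: aux tw _ _ _ yE zE xE h1.
have [h2|h2] := ltrP 0 (k2 * x2%:~R).
  apply: aux (frame_rot tw) k20 k30 k10 _ _ _ h2; lra.
have [h3|h3] := ltrP 0 (k3 * x3%:~R).
  apply: aux (frame_rot (frame_rot tw)) k30 k10 k20 _ _ _ h3; lra.
by apply: (@absurd_lt R); lra.
Qed.

(** By convexity a small step from C stays in P in any direction of the cone on rays that
start inside P. *)
Lemma local_cone C1 C2 x1 y1 z1 x2 y2 z2 x3 y3 z3 s (a1 a2 a3 : R) :
  0 < s -> s <= 1 -> Q 0 C1 C2 ->
  Q (s * x1) (C1 + s * y1) (C2 + s * z1) ->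
  Q (s * x2) (C1 + s * y2) (C2 + s * z2) ->
  Q (s * x3) (C1 + s * y3) (C2 + s * z3) ->
  0 <= a1 -> 0 <= a2 -> 0 <= a3 ->
  exists2 t : R, 0 < t & Q (t * (a1 * x1 + a2 * x2 + a3 * x3))
   (C1 + t * (a1 * y1 + a2 * y2 + a3 * y3)) (C2 + t * (a1 * z1 + a2 * z2 + a3 * z3)).
Proof.
move=> s0 s1 QC Q1 Q2 Q3 a10 a20 a30.
have S0 : 0 < 1 + a1 + a2 + a3 by lra.
have S00 : 1 + a1 + a2 + a3 != 0 by rewrite gt_eqF.
exists (s / (1 + a1 + a2 + a3)); first by rewrite divr_gt0.
have Q12 : Q (s * ((a1 * x1) / (1 + a1))) (C1 + s * (a1 * y1 / (1 + a1)))
   (C2 + s * (a1 * z1 / (1 + a1))).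
  apply: (pt_comb bP QC Q1 (s := 1) (t := a1)) => //; try lra; field; lra.
have Q123 : Q (s * ((a1 * x1 + a2 * x2) / (1 + a1 + a2)))
   (C1 + s * ((a1 * y1 + a2 * y2) / (1 + a1 + a2)))
   (C2 + s * ((a1 * z1 + a2 * z2) / (1 + a1 + a2))).
  apply: (pt_comb bP Q12 Q2 (s := 1 + a1) (t := a2)) => //; try lra;
   field; apply/andP; split; lra.
apply: (pt_comb bP Q123 Q3 (s := 1 + a1 + a2) (t := a3)) => //; try lra;
   field; apply/andP; split; lra.
Qed.

End Slice.

(** * Reaching the opposite column *)

Section Opposite.
Variable R : realType.
Variables (P : set 'rV[R]_3) (vx : set 'rV[int]_3).
Hypothesis bP : body P vx.
Variables (u p q e : 'rV[int]_3) (a : int).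
Hypothesis tu : frame P vx u p q e.
Hypothesis uE : u = zpt p q e (-1) (-1) a.
Let bs := frame_basis tu.
Local Notation Q := (fun x y z : R => P (pt p q e x y z)).
Local Notation zp := (zpt p q e).

(** Used to show that the origin has positive coordinates in the frame of any vertex. *)
Lemma backward_in (x y z : int) : exists2 t : R, 0 < t &
  Q (- (t * x%:~R)) (- (t * y%:~R)) (- (t * z%:~R)).
Proof.
have [d d0 hd] := pt_around p q e bP.
pose S : R := 1 + `|x%:~R| + `|y%:~R| + `|z%:~R|.
have nx : 0 <= `|x%:~R : R| by []. have ny : 0 <= `|y%:~R : R| by [].
have nz : 0 <= `|z%:~R : R| by [].
have S0 : 0 < S by rewrite /S; lra.
have t0 : 0 < d / S by rewrite divr_gt0.
have bound (r : R) : `|r| <= S -> `|- (d / S * r)| <= d.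
  move=> rS; rewrite normrN normrM gtr0_norm // -[leRHS](divfK (lt0r_neq0 S0)).
  by rewrite ler_wpM2l // ltW.
by exists (d / S) => //; apply: hd; apply: bound; rewrite /S; lra.
Qed.

Lemma int_unit_pm (d k : int) : d * k = 1 -> d = 1 \/ d = -1.
Proof.
move=> h; have [d0|d0] := lerP 0 d.
  have k0 : 0 <= k by nia.
  by left; have [] := @unit_factors 1 d k; rewrite ?mul1r.
have k0 : k <= 0 by nia.
have h1 : 1 * (- d * - k) = 1 by rewrite mul1r mulrNN.
by right; have [||] := unit_factors h1; lia.
Qed.

(** Since the origin is interior, a small step against the first ray stays in P, so
the first coordinate of the origin in the frame at (0, 0, l) is positive; it is - l
times that of (0, 0, 1). The second inequality says that (0, -1, a) is in the cone. *)
Lemma axis_vertex_first l x1 y1 z1 x2 y2 z2 x3 y3 z3 d : l <= -1 ->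
  frame P vx (zp 0 0 l) (zp x1 y1 z1) (zp x2 y2 z2) (zp x3 y3 z3) ->
  d * det3 x1 y1 z1 x2 y2 z2 x3 y3 z3 = 1 ->
  0 < d * det3 0 0 1 x2 y2 z2 x3 y3 z3 /\
  0 <= d * det3 0 (-1) (a - l) x2 y2 z2 x3 y3 z3.
Proof.
move=> l1 tw D.
have DR : d%:~R * det3 x1%:~R y1%:~R z1%:~R x2%:~R y2%:~R z2%:~R
   x3%:~R y3%:~R z3%:~R = 1 :> R.
  transitivity ((d * det3 x1 y1 z1 x2 y2 z2 x3 y3 z3)%:~R : R); last by rewrite D.
  by rewrite /det3; ring.
split.
  have [t t0 Qt] := backward_in x1 y1 z1.
  have [k1 [k2 [k3 [[k10 _ _] [xE yE zE]]]]] := frame_cone bs tw Qt.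
  have [k1E _ _] := @cramer3 R _ _ _ _ _ _ _ _ _ _ DR
     (- (t * x1%:~R)) (- (t * y1%:~R)) (- (t * z1%:~R) - l%:~R) k1 k2 k3
     ltac:(lra) ltac:(lra) ltac:(lra).
  have : k1 = - t - l%:~R * (d * det3 0 0 1 x2 y2 z2 x3 y3 z3)%:~R.
    transitivity (- t * (d%:~R * det3 x1%:~R y1%:~R z1%:~R x2%:~R y2%:~R z2%:~R
        x3%:~R y3%:~R z3%:~R) - l%:~R * (d * det3 0 0 1 x2 y2 z2 x3 y3 z3)%:~R).
      by rewrite k1E /det3; ring.
    by rewrite DR mulr1.
  move=> k1t; rewrite -(ltr0z R).
  have lR : (l%:~R : R) < 0 by rewrite (ltr_int R l 0); lia.
  rewrite -(nmulr_rlt0 _ lR); lra.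
have [k1 [k2 [k3 [[k10 _ _] [xE yE zE]]]]] := frame_cone bs tw (corner_p bP tu uE).
have [k1E _ _] := @cramer3 R _ _ _ _ _ _ _ _ _ _ DR
     0 (-1) (a%:~R - l%:~R) k1 k2 k3
     ltac:(lra) ltac:(lra) ltac:(lra).
rewrite -(ler0z R); move: k10; rewrite k1E /det3 => h.
by apply: le_trans h _; rewrite le_eqVlt; apply/orP; left; apply/eqP; ring.
Qed.

(** The weights m and a are the coordinates of (0, 0, 1) and of (0, -1, a - l) in the
frame. The last three conditions replace one ray by (0, 0, 1) in the determinant. *)
Lemma axis_vertex l x1 y1 z1 x2 y2 z2 x3 y3 z3 : l <= -1 ->
  frame P vx (zp 0 0 l) (zp x1 y1 z1) (zp x2 y2 z2) (zp x3 y3 z3) ->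
  exists m1 m2 m3 a1 a2 a3 : int,
  [/\ [/\ 0 < m1, 0 < m2 & 0 < m3], [/\ 0 <= a1, 0 <= a2 & 0 <= a3],
      [/\ m1 * x1 + m2 * x2 + m3 * x3 = 0, m1 * y1 + m2 * y2 + m3 * y3 = 0
        & m1 * z1 + m2 * z2 + m3 * z3 = 1],
      [/\ a1 * x1 + a2 * x2 + a3 * x3 = 0, a1 * y1 + a2 * y2 + a3 * y3 = -1
        & a1 * z1 + a2 * z2 + a3 * z3 = a - l]
    & [/\ x1 * y2 - x2 * y1 = m3 \/ x1 * y2 - x2 * y1 = - m3,
          x2 * y3 - x3 * y2 = m1 \/ x2 * y3 - x3 * y2 = - m1
        & x3 * y1 - x1 * y3 = m2 \/ x3 * y1 - x1 * y3 = - m2]].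
Proof.
move=> l1 tw.
have [d D] := frame_det bs tw.
have [m1 a1] := axis_vertex_first l1 tw D.
have D2 : d * det3 x2 y2 z2 x3 y3 z3 x1 y1 z1 = 1 by rewrite -[RHS]D /det3; ring.
have [m2 a2] := axis_vertex_first l1 (frame_rot tw) D2.
have D3 : d * det3 x3 y3 z3 x1 y1 z1 x2 y2 z2 = 1 by rewrite -[RHS]D /det3; ring.
have [m3 a3] := axis_vertex_first l1 (frame_rot (frame_rot tw)) D3.
do 6 eexists; split.
- by split; [exact: m1|exact: m2|exact: m3].
- by split; [exact: a1|exact: a2|exact: a3].
- have [ex ey ez] := @cramer3_sol _ _ _ _ _ _ _ _ _ _ _ D 0 0 1.
  by split; [rewrite [RHS]ex|rewrite [RHS]ey|rewrite [RHS]ez]; rewrite /det3; ring.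
- have [ex ey ez] := @cramer3_sol _ _ _ _ _ _ _ _ _ _ _ D 0 (-1) (a - l).
  by split; [rewrite [RHS]ex|rewrite [RHS]ey|rewrite [RHS]ez]; rewrite /det3; ring.
- have [-> | ->] := int_unit_pm D; rewrite /det3.
    by split; left; ring.
  by split; right; ring.
Qed.

(** Points over y >= 1 are seen from the axis through the column over (0, 1). *)
Lemma forward_le (z0 y z : R) : (forall t, Q 0 1 t -> - a%:~R < t) ->
  Q 0 0 z0 -> Q 0 y z -> 1 <= y -> - a%:~R * y < (y - 1) * z0 + z.
Proof.
move=> H Q0 Qy y1; have yp : 0 < y by lra.
have : Q 0 1 (((y - 1) * z0 + z) / y).
  apply: (pt_comb bP Q0 Qy (s := y - 1) (t := 1)); try lra; field; lra.
by move=> /H; rewrite ltr_pdivlMr.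
Qed.

Lemma int_ge1 (b : int) : 0 < b -> (1 : R) <= b%:~R.
Proof. by rewrite (ler_int R 1); lia. Qed.

Section AxisPoint.
(* The point C = (0, 0, l) with a sharp corner of the slice: in the (y, z) plane the
   boundary follows the line from (-1, a) to C, and leaves C above the line towards
   (1, - a). *)
Variable l : int.
Hypothesis l1 : l <= -1.
Hypothesis left : forall y z, Q 0 y z -> l%:~R <= - (l%:~R - a%:~R) * y + z.
Hypothesis right : forall t, 0 < t -> ~ Q 0 t (l%:~R + t * (- a%:~R - l%:~R)).

Section Rays.
Variables (s : R) (x1 y1 z1 x2 y2 z2 x3 y3 z3 m1 m2 m3 a1 a2 a3 : int).
Hypothesis QC : Q 0 0 l%:~R.
Hypotheses (s0 : 0 < s) (s1 : s <= 1).
Hypothesis Q1 : Q (s * x1%:~R) (s * y1%:~R) (l%:~R + s * z1%:~R).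
Hypothesis Q2 : Q (s * x2%:~R) (s * y2%:~R) (l%:~R + s * z2%:~R).
Hypothesis Q3 : Q (s * x3%:~R) (s * y3%:~R) (l%:~R + s * z3%:~R).
Hypotheses (m10 : 0 <= m1) (m20 : 0 <= m2) (m30 : 0 <= m3).
Hypotheses (mx : m1 * x1 + m2 * x2 + m3 * x3 = 0)
  (my : m1 * y1 + m2 * y2 + m3 * y3 = 0) (mz : m1 * z1 + m2 * z2 + m3 * z3 = 1).
Hypotheses (ax : a1 * x1 + a2 * x2 + a3 * x3 = 0)
  (ay : a1 * y1 + a2 * y2 + a3 * y3 = -1)
  (az : a1 * z1 + a2 * z2 + a3 * z3 = a - l).

(** The direction k (0, 0, 1) + c (0, -1, a - l) has nonnegative weights on the rays. *)
Lemma slice_direction (k c : R) :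
  0 <= k * m1%:~R + c * a1%:~R -> 0 <= k * m2%:~R + c * a2%:~R ->
  0 <= k * m3%:~R + c * a3%:~R ->
  exists2 t : R, 0 < t & Q 0 (t * - c) (l%:~R + t * (k + c * (a%:~R - l%:~R))).
Proof.
move=> b1 b2 b3; have Q1' := Q1; have Q2' := Q2; have Q3' := Q3.
rewrite -[s * y1%:~R]add0r in Q1'; rewrite -[s * y2%:~R]add0r in Q2'.
rewrite -[s * y3%:~R]add0r in Q3'.
have [t t0 Qt] := local_cone bP s0 s1 QC Q1' Q2' Q3' b1 b2 b3.
exists t => //; move: Qt; congr (P (pt p q e _ _ _)).
- transitivity (t * (k * (m1 * x1 + m2 * x2 + m3 * x3)%:~R
    + c * (a1 * x1 + a2 * x2 + a3 * x3)%:~R)); first by ring.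
  by rewrite mx ax !mulr0 addr0 mulr0.
- transitivity (t * (k * (m1 * y1 + m2 * y2 + m3 * y3)%:~R
    + c * (a1 * y1 + a2 * y2 + a3 * y3)%:~R)); first by ring.
  by rewrite my ay; ring.
- transitivity (l%:~R + t * (k * (m1 * z1 + m2 * z2 + m3 * z3)%:~R
    + c * (a1 * z1 + a2 * z2 + a3 * z3)%:~R)); first by ring.
  by rewrite mz az; ring.
Qed.

(** If all a_i <= 2 m_i, then (0, 1, - a - l) = - 2 l (0, 0, 1) - (0, -1, a - l) points
into P, against the assumption on the right. If the a_i are positive, the point
(0, -1, a) can be lowered, against the assumption on the left. The alternative
a1 = m1 allows for a vanishing first ray. *)
Lemma frame_weights :
  ~ [/\ a1 <= 2 * m1, a2 <= 2 * m2 & a3 <= 2 * m3] /\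
  ~ [/\ 0 < a1 \/ a1 = m1, 0 < a2 & 0 < a3].
Proof.
split=> [[h1 h2 h3]|[h1 h2 h3]].
  have beta (m b : int) : 0 <= m -> b <= 2 * m ->
      (0 : R) <= (-2 * l)%:~R * m%:~R + -1 * b%:~R.
    by move=> ? ?; rewrite mulN1r -intrM -intrB ler0z; nia.
  have [t t0] := slice_direction (beta _ _ m10 h1) (beta _ _ m20 h2) (beta _ _ m30 h3).
  rewrite opprK mulr1.
  have -> : (-2 * l)%:~R + -1 * (a%:~R - l%:~R) = - a%:~R - l%:~R :> R by ring.
  exact: right.
pose d : R := (1 + m1%:~R + m2%:~R + m3%:~R)^-1.
have [m1R m2R m3R] : [/\ (0 : R) <= m1%:~R, (0 : R) <= m2%:~R & (0 : R) <= m3%:~R].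
  by rewrite !ler0z.
have d0 : 0 < d by rewrite invr_gt0; lra.
have dE : d * (1 + m1%:~R + m2%:~R + m3%:~R) = 1.
  by rewrite mulVf // gt_eqF //; lra.
have [dm1 dm2 dm3] : [/\ 0 <= d * m1%:~R, 0 <= d * m2%:~R & 0 <= d * m3%:~R].
  by split; rewrite mulr_ge0 // ltW.
have h1' : (0 : R) <= - d * m1%:~R + 1 * a1%:~R.
  case: h1 => [/int_ge1|->]; first by lra.
  have : d * m1%:~R <= 1 * m1%:~R by rewrite ler_wpM2r //; lra.
  by lra.
have h2' : (0 : R) <= - d * m2%:~R + 1 * a2%:~R by move/int_ge1: h2; lra.
have h3' : (0 : R) <= - d * m3%:~R + 1 * a3%:~R by move/int_ge1: h3; lra.
have [t t0 /left] := slice_direction h1' h2' h3'.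
have td : 0 < t * d by rewrite mulr_gt0.
by apply/negP; rewrite -ltNge; lra.
Qed.

End Rays.

(** Some a_i vanishes, and then the arithmetic bound gives all a_i <= 2 m_i. *)
Lemma axis_not_vertex : ~ vx (zp 0 0 l).
Proof.
move=> vC.
have QC : Q 0 0 l%:~R := pt_vx bP vC.
have [r1 [r2 [r3 tw]]] := body_frame bP vC.
have [x1 [y1 [z1 r1E]]] := zpt_surj bs r1.
have [x2 [y2 [z2 r2E]]] := zpt_surj bs r2.
have [x3 [y3 [z3 r3E]]] := zpt_surj bs r3.
rewrite r1E r2E r3E in tw.
have step x y z s2 s3 : frame P vx (zp 0 0 l) (zp x y z) s2 s3 ->
    [/\ Q (1 * x%:~R) (1 * y%:~R) (l%:~R + 1 * z%:~R) & -1 <= x].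
  move=> /(frame_step bP)[_ [_ _]]; rewrite !add0r intrD !mul1r => Qx.
  by split=> //; have [+ _ _] := corner_lower tu uE Qx; rewrite (ler_int R (-1)).
have [Q1 x1m] := step _ _ _ _ _ tw.
have [Q2 x2m] := step _ _ _ _ _ (frame_rot tw).
have [Q3 x3m] := step _ _ _ _ _ (frame_rot (frame_rot tw)).
have [m1 [m2 [m3 [a1 [a2 [a3 [[m10 m20 m30] [a10 a20 a30] [mx my mz] [ax ay az] [D3 D1 D2]]]]]]]] :=
  axis_vertex l1 tw.
have [nle npos] := frame_weights QC ltr01 (lexx _) Q1 Q2 Q3
  (ltW m10) (ltW m20) (ltW m30) mx my mz ax ay az.
apply: nle.
have some0 : a1 = 0 \/ a2 = 0 \/ a3 = 0.
  have [//|h] := pselect (a1 = 0 \/ a2 = 0 \/ a3 = 0).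
  by exfalso; apply: npos; split; first left; lia.
case: some0 => [|[|]] h0; rewrite h0 !mul0r ?add0r ?addr0 in ax ay.
- split; first by lia.
    by apply: (@ray_weight_le x2 y2 x3 y3 x1 m2 m3 m1 a2 a3) => //; lia.
  by apply: (@ray_weight_le x3 y3 x2 y2 x1 m3 m2 m1 a3 a2) => //; lia.
- split; last by apply: (@ray_weight_le x3 y3 x1 y1 x2 m3 m1 m2 a3 a1) => //; lia.
    by apply: (@ray_weight_le x1 y1 x3 y3 x2 m1 m3 m2 a1 a3) => //; lia.
  by lia.
- split; last by lia.
    by apply: (@ray_weight_le x1 y1 x2 y2 x3 m1 m2 m3 a1 a2) => //; lia.
  by apply: (@ray_weight_le x2 y2 x1 y1 x3 m2 m1 m3 a2 a1) => //; lia.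
Qed.

(** When (0, 0, l) is inside an edge crossing the slice, P agrees near it with the cone
on the two rays lying in the slice. One of the weights of (0, -1, a - l) vanishes and
the other then divides 1. *)
Lemma axis_not_slice_vertex : Q 0 0 l%:~R -> ~ slice_vertex P vx p q e 0 l.
Proof.
move=> QC [/axis_not_vertex//|[wy [wz [y1 [z1 [y2 [z2 [y3 [z3 [tw wyE wzE]]]]]]]]]].
have [n [n0 vn Q1]] := frame_step bP tw.
have [n1|n2] : n = 1 \/ 2 <= n by lia.
  by apply: axis_not_vertex; move: vn; rewrite n1 mul1r addNr !mul1r -wyE -wzE.
have Qn := pt_vx bP vn.
have n2R : (2 : R) <= n%:~R by rewrite (ler_int R 2).
have wyR : wy%:~R = - y1%:~R :> R by rewrite -intrN; congr (_ %:~R); lia.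
have wzR : wz%:~R = l%:~R - z1%:~R :> R by rewrite -intrB; congr (_ %:~R); lia.
(* The edge continues beyond C, so a step s along the rays of w fits at C as well. *)
pose s : R := (n%:~R - 1) / n%:~R.
have nn0 : n%:~R != 0 :> R by rewrite gt_eqF //; lra.
have s0 : 0 < s by rewrite divr_gt0; lra.
have s1 : s <= 1 by rewrite ler_pdivrMr; lra.
have ray y z s2 s3 : frame P vx (zp (-1) wy wz) (zp 0 y z) s2 s3 ->
    Q (s * 0%:~R) (s * y%:~R) (l%:~R + s * z%:~R).
  move=> /(frame_step bP)[_ [_ _]]; rewrite !addr0 => Qr.
  apply: (pt_comb bP Qr Qn (s := n%:~R - 1) (t := 1)); try lra;
    rewrite !(intrD, intrM, intrN) ?wyR ?wzR /s; field => //.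
have Q2 := ray _ _ _ _ (frame_rot tw).
have Q3 := ray _ _ _ _ (frame_rot (frame_rot tw)).
have [d D] := frame_det bs tw.
have {}D : d * (y2 * z3 - z2 * y3) = 1 by rewrite -D /det3; ring.
have DR : d%:~R * (y2%:~R * z3%:~R - z2%:~R * y3%:~R) = 1 :> R.
  by transitivity ((d * (y2 * z3 - z2 * y3))%:~R : R); [ring|rewrite D].
(* In the slice the first weight is 1, so C may replace w as apex of the cone. *)
have coord y z : Q 0 y z -> 0 <= d%:~R * (y * z3%:~R - (z - l%:~R) * y3%:~R) /\
    0 <= d%:~R * (y2%:~R * (z - l%:~R) - z2%:~R * y).
  move=> /(frame_cone bs tw)[k1 [k2 [k3 [[k10 k20 k30] [ex ey ez]]]]].
  have k1E : k1 = 1 by lra.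
  rewrite wyR k1E in ey; rewrite wzR k1E in ez.
  have -> : y = k2 * y2%:~R + k3 * y3%:~R by lra.
  have -> : z = l%:~R + (k2 * z2%:~R + k3 * z3%:~R) by lra.
  split.
    have -> : d%:~R * ((k2 * y2%:~R + k3 * y3%:~R) * z3%:~R -
      (l%:~R + (k2 * z2%:~R + k3 * z3%:~R) - l%:~R) * y3%:~R) =
      k2 * (d%:~R * (y2%:~R * z3%:~R - z2%:~R * y3%:~R)) by ring.
    by rewrite DR mulr1.
  have -> : d%:~R * (y2%:~R * (l%:~R + (k2 * z2%:~R + k3 * z3%:~R) - l%:~R) -
      z2%:~R * (k2 * y2%:~R + k3 * y3%:~R)) =
      k3 * (d%:~R * (y2%:~R * z3%:~R - z2%:~R * y3%:~R)) by ring.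
  by rewrite DR mulr1.
have QP := corner_p bP tu uE.
have [a2 a3] := coord _ _ QP.
have {}a2 : 0 <= d * (- z3 - (a - l) * y3).
  rewrite -(ler0z R); apply: le_trans a2 _; rewrite le_eqVlt; apply/orP; left.
  by apply/eqP; ring.
have {}a3 : 0 <= d * (y2 * (a - l) + z2).
  rewrite -(ler0z R); apply: le_trans a3 _; rewrite le_eqVlt; apply/orP; left.
  by apply/eqP; ring.
have lR : (l%:~R : R) < 0 by rewrite (ltr_int R l 0); lia.
have m2 : 0 < - d * y3.
  have [t t0 Qt] := backward_in 0 y2 z2; rewrite mulr0 oppr0 in Qt.
  have [h _] := coord _ _ Qt.
  have hE : d%:~R * (- (t * y2%:~R) * z3%:~R - (- (t * z2%:~R) - l%:~R) * y3%:~R) =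
    - t * (d%:~R * (y2%:~R * z3%:~R - z2%:~R * y3%:~R)) - l%:~R * (- d * y3)%:~R :> R by ring.
  rewrite hE DR in h.
  by rewrite -(ltr0z R) -(nmulr_rlt0 _ lR); lra.
have m3 : 0 < d * y2.
  have [t t0 Qt] := backward_in 0 y3 z3; rewrite mulr0 oppr0 in Qt.
  have [_ h] := coord _ _ Qt.
  have hE : d%:~R * (y2%:~R * (- (t * z3%:~R) - l%:~R) - z2%:~R * (- (t * y3%:~R))) =
    - t * (d%:~R * (y2%:~R * z3%:~R - z2%:~R * y3%:~R)) - l%:~R * (d * y2)%:~R :> R by ring.
  rewrite hE DR in h.
  by rewrite -(ltr0z R) -(nmulr_rlt0 _ lR); lra.
have ay : d * (- z3 - (a - l) * y3) * y2 + d * (y2 * (a - l) + z2) * y3 = -1.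
  by rewrite -[1 in RHS]D; ring.
have az : d * (- z3 - (a - l) * y3) * z2 + d * (y2 * (a - l) + z2) * z3 = a - l.
  by rewrite -[a - l in RHS]mulr1 -D; ring.
have mz : - d * y3 * z2 + d * y2 * z3 = 1 by rewrite -[RHS]D; ring.
have my : - d * y3 * y2 + d * y2 * y3 = 0 by ring.
have Q0 : Q (s * 0%:~R) (s * 0%:~R) (l%:~R + s * 0%:~R).
  by rewrite !mulr0 addr0.
have [nle npos] := @frame_weights s 0 0 0 0 y2 z2 0 y3 z3 0 _ _ 0 _ _ QC s0 s1 Q0 Q2 Q3 (lexx _) (ltW m2) (ltW m3)
   ltac:(by rewrite !mulr0 !addr0) ltac:(by rewrite mulr0 add0r) ltac:(by rewrite mulr0 add0r)
   ltac:(by rewrite !mulr0 !addr0) ltac:(by rewrite mulr0 add0r; exact: ay) ltac:(by rewrite mulr0 add0r; exact: az).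
move: nle npos ay a2 a3 m2 m3.
set A2 := d * (- z3 - _); set A3 := d * (y2 * _ + _); set M2 := - d * y3; set M3 := d * y2.
move=> nle npos ay a2 a3 m2 m3.
apply: nle; split; first by [].
- have [h|h] := lerP A2 (2 * M2); first by [].
  exfalso; apply: npos; split; [by right|by lia|].
  case: (ltgtP 0 A3) a3 => // A30 _; rewrite -A30 mul0r addr0 in ay.
  have := @int_unit_pm A2 (- y2); rewrite mulrN ay opprK => /(_ erefl); lia.
- have [h|h] := lerP A3 (2 * M3); first by [].
  exfalso; apply: npos; split; [by right| |by lia].
  case: (ltgtP 0 A2) a2 => // A20 _; rewrite -A20 mul0r add0r in ay.
  have := @int_unit_pm A3 (- y3); rewrite mulrN ay opprK => /(_ erefl); lia.
Qed.

End AxisPoint.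

(** If the column over (0, 1) were above - a, then minimising a y + z over the slice would
select a lattice point (0, 0, l) with l <= -1. In the (y, z) plane the boundary of the
slice follows near it the segment to (-1, a) on one side, and stays above the ray in
direction (1, - a - l) on the other. No vertex of the slice has such a corner. *)
Lemma opposite_below : Q 0 0 (-1) -> exists2 t : R, t <= - a%:~R & Q 0 1 t.
Proof.
move=> Qm; apply: contrapT => nex.
have H t : Q 0 1 t -> - a%:~R < t.
  by move=> Qt; rewrite ltNge; apply/negP => ta; apply: nex; exists t.
have up := forward_le H.
have y_cases (y : int) z : Q 0 y%:~R z -> [\/ y = -1, y = 0 | 1 <= y].
  move=> /(corner_lower tu uE)[_ + _]; rewrite (ler_int R (-1)) => ?.
  have [|[|]] : y = -1 \/ y = 0 \/ 1 <= y by lia.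
  - exact: Or31.
  - exact: Or32.
  - exact: Or33.
have zlow y z : Q 0 y z -> a%:~R <= z by case/(corner_lower tu uE).
have [cy [l [sv QC hmin]]] := slice_vertexP bP tu uE a%:~R 1.
(* The slope -a is chosen so that only lattice points of the axis can be optimal. *)
have cy0 : cy = 0.
  have := hmin _ _ Qm; rewrite mulr0 => h.
  case: (y_cases _ _ QC) => // cyE; exfalso.
    by have := zlow _ _ QC; move: h; rewrite cyE; apply: contraTnot => ?; lra.
  have cyR : (1 : R) <= cy%:~R by rewrite (ler_int R 1).
  have := up _ _ _ Qm QC cyR; lra.
subst cy.
have l1R : (l%:~R : R) <= -1 by have := hmin _ _ Qm; lra.
have l1 : l <= -1 by rewrite -(ler_int R).
have {}hmin y z : Q 0 y z -> l%:~R <= a%:~R * y + z by move=> /hmin; lra.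
(* Sliding the supporting line until it contains (-1, a) meets no lower lattice
   point: those over y = -1 are at least a high, those with y >= 1 are too high. *)
have left y z : Q 0 y z -> l%:~R <= - (l%:~R - a%:~R) * y + z.
  have [cy [cz [_ QC' h]]] := slice_vertexP bP tu uE (- (l%:~R - a%:~R)) 1.
  move=> /h hyz.
  suff : l%:~R <= - (l%:~R - a%:~R) * cy%:~R + 1 * cz%:~R :> R by lra.
  have zc := zlow _ _ QC'.
  case: (y_cases _ _ QC') => [cyE|cyE|cyE].
  - by rewrite cyE; lra.
  - by have := hmin _ _ QC'; rewrite cyE; lra.
  - have cyR : (1 : R) <= cy%:~R by rewrite (ler_int R 1).
    have := up _ _ _ QC QC' cyR.
    have : 0 <= - l%:~R * cy%:~R :> R by rewrite mulr_ge0; lra.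
    lra.
(* Points on the line from C towards (1, -a) would be a minimum of a slightly
   steeper functional, hence dominated by a lattice point over y >= 1; the latter
   are strictly above that line, by at least 1 since heights are integral. *)
have right t : 0 < t -> Q 0 t (l%:~R + t * (- a%:~R - l%:~R)) -> False.
  move=> t0 Qt.
  have [K K0 hK] := pt_bounded bs bP.
  (* The tilt is less than 1 over the whole range of y. *)
  pose dl : R := (1 + K)^-1.
  have dl0 : 0 < dl by rewrite invr_gt0; lra.
  have dlK : dl * (1 + K) = 1 by rewrite mulVf //; lra.
  have [cy [cz [_ QC' h]]] := slice_vertexP bP tu uE (a%:~R + l%:~R - dl) 1.
  have := h _ _ Qt.
  have tdl : 0 < t * dl by rewrite mulr_gt0.
  have zc := zlow _ _ QC'.
  case: (y_cases _ _ QC') => [cyE|cyE|cyE].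
  - by rewrite cyE; apply/negP; rewrite -ltNge; lra.
  - have := hmin _ _ QC'; rewrite cyE => ?.
    by apply/negP; rewrite -ltNge; lra.
  - have cyR : (1 : R) <= cy%:~R by rewrite (ler_int R 1).
    have upc := up _ _ _ QC QC' cyR.
    have : ((- a * cy)%:~R : R) < ((cy - 1) * l + cz)%:~R.
      by rewrite !(intrD, intrM, intrN); lra.
    rewrite ltr_int => iup.
    have : ((- a * cy + 1)%:~R : R) <= ((cy - 1) * l + cz)%:~R.
      by rewrite ler_int; lia.
    rewrite !(intrD, intrM, intrN) => iupR.
    have cK := hK _ _ _ QC'.
    have : dl * cy%:~R <= dl * K by rewrite ler_wpM2l // ltW.
    by move=> ?; apply/negP; rewrite -ltNge; lra.
exact: axis_not_slice_vertex l1 left right QC sv.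
Qed.

End Opposite.

(** * Symmetric lattice bases *)

Section Final.
Variable R : realType.
Variables (P : set 'rV[R]_3) (vx : set 'rV[int]_3).
Hypothesis bP : body P vx.

Lemma zpt_flip (p q e : 'rV[int]_3) n c d a :
  zpt p q e (-1) (-1) a + n *: e =
  zpt (p + c *: e) (q + d *: e) (- e) (-1) (-1) (- (a + n + c + d)).
Proof. by apply/rowP => i; rewrite !mxE; ring. Qed.

Lemma pt_flip (p q e : 'rV[int]_3) (c d : int) (x y z : R) :
  pt (p + c *: e) (q + d *: e) (- e) x y z =
  pt p q e x y (c%:~R * x + d%:~R * y - z).
Proof. by rewrite !pt_def !toRD toRN !toRZ; apply/rowP => i; rewrite !mxE; ring. Qed.

Lemma zpt_rot (p q e : 'rV[int]_3) x y z : zpt q e p y z x = zpt p q e x y z.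
Proof. by apply/rowP => i; rewrite !mxE; ring. Qed.

Lemma pt_rot (p q e : 'rV[int]_3) (x y z : R) : pt q e p y z x = pt p q e x y z.
Proof. by rewrite !pt_def; apply/rowP => i; rewrite !mxE; ring. Qed.

Section Column.
Variables (u p q e : 'rV[int]_3) (a : int).
Hypothesis tu : frame P vx u p q e.
Hypothesis uE : u = zpt p q e (-1) (-1) a.
Let bs := frame_basis tu.
Local Notation Q := (fun x y z : R => P (pt p q e x y z)).

(** If the lattice point found beyond the axis is over y >= 2, its segments to (0, 0, 1)
and (0, 0, -1) cut the column over (0, 1) at heights at least 1 apart. *)
Lemma lattice_point_beyond : Q 0 0 1 -> Q 0 0 (-1) ->
  exists t : int, Q 0 1 t%:~R.
Proof.
move=> Q1 Qm.
have [cy [cz [_ QC h]]] := slice_vertexP bP tu uE (-1) 0.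
have cy1 : 1 <= cy.
  have [d d0 hd] := pt_around p q e bP.
  have Qd : Q 0 d 0 by apply: hd; rewrite ?normr0 ?(gtr0_norm d0) ?(ltW d0).
  have := h _ _ Qd => hh.
  have : (0 : R) < cy%:~R by lra.
  by rewrite ltr0z; lia.
have cy1R : (1 : R) <= cy%:~R by rewrite (ler_int R 1).
have cy0 : cy%:~R != 0 :> R by rewrite gt_eqF //; lra.
have [cyE|cy2] : cy = 1 \/ 2 <= cy by lia.
  by exists cz; rewrite cyE in QC.
have cy2R : (2 : R) <= cy%:~R by rewrite (ler_int R 2).
pose lo : R := (cz%:~R - (cy%:~R - 1)) / cy%:~R.
pose hi : R := (cz%:~R + (cy%:~R - 1)) / cy%:~R.
have Qlo : Q 0 1 lo.
  by apply: (pt_comb bP Qm QC (s := cy%:~R - 1) (t := 1)); rewrite /lo; try lra; field.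
have Qhi : Q 0 1 hi.
  by apply: (pt_comb bP Q1 QC (s := cy%:~R - 1) (t := 1)); rewrite /hi; try lra; field.
have loE : lo * cy%:~R = cz%:~R - (cy%:~R - 1) by rewrite divfK.
have hiE : hi * cy%:~R = cz%:~R + (cy%:~R - 1) by rewrite divfK.
have wide : lo + 1 <= hi.
  rewrite -(ler_pM2r (_ : 0 < cy%:~R)); last by lra.
  by rewrite mulrDl loE hiE; lra.
have f1 := Num.Theory.floor_le hi; have f2 := Num.Theory.floorD1_gt hi.
rewrite intrD in f2.
exists (Num.floor hi).
by apply: (pt_comb bP Qlo Qhi (s := hi - (Num.floor hi)%:~R) (t := (Num.floor hi)%:~R - lo)); try lra; ring.
Qed.

(** The heights a and m over (0, -1) come from the edges p at u and p' at v. By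
opposite_below at u and at v, the column over (0, 1) contains heights t1 <= - a and
t2' >= - m. With one integer height in between, the column contains an integer in
[- m, - a]. *)
Lemma symmetric_in_column : Q 0 0 1 -> Q 0 0 (-1) ->
  exists t : int, Q 0 1 t%:~R /\ Q 0 (-1) (- t%:~R).
Proof.
move=> Q1 Qm.
have [n [c [d [n0 tv]]]] := edge_flip bP tu.
have vE : u + n *: e = _ := etrans (congr1 (fun w => w + n *: e) uE) (zpt_flip p q e n c d a).
have [t1 t1a Qt1] := opposite_below bP tu uE Qm.
have [t2 t2a] : exists2 t : R, t <= - (- (a + n + c + d))%:~R &
    P (pt (p + c *: e) (q + d *: e) (- e) 0 1 t).
  apply: (opposite_below bP tv vE); rewrite pt_flip !mulr0 !add0r opprK //.
rewrite pt_flip mulr0 mulr1 add0r => Qt2.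
have := corner_p bP tv vE; rewrite pt_flip mulr0 add0r mulrN1.
set m := (_ - _ : R) => Qm1.
have mE : m = (a + n + c)%:~R by rewrite /m !(intrD, intrN); ring.
have Qa1 := corner_p bP tu uE.
have [_ _ am] := corner_lower tu uE Qm1.
have t2m : - m <= d%:~R - t2 by rewrite mE; move: t2a; rewrite !(intrD, intrN); lra.
suff [t [Qt ta tm]] : exists t : int, [/\ Q 0 1 t%:~R, t%:~R <= - a%:~R :> R & - m <= t%:~R].
  exists t; split=> //.
  have [ma|ma] := eqVneq m a%:~R.
    by have -> : - t%:~R = a%:~R :> R by lra.
  have ma' : a%:~R < m by rewrite lt_neqAle eq_sym ma.
  by apply: (pt_comb bP Qa1 Qm1 (s := m + t%:~R) (t := - t%:~R - a%:~R)); try lra; ring.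
have [t Qt] := lattice_point_beyond Q1 Qm.
have [ta|ta] := lerP t%:~R (- a%:~R : R); last first.
  exists (- a); rewrite intrN; split; [|by []|lra].
  by apply: (pt_comb bP Qt1 Qt (s := t%:~R + a%:~R) (t := - a%:~R - t1)); try lra; ring.
have [tm|tm] := lerP (- m) t%:~R; first by exists t.
exists (- (a + n + c)); rewrite intrN -mE; split; [|lra|by []].
by apply: (pt_comb bP Qt Qt2 (s := d%:~R - t2 + m) (t := - m - t%:~R)); try lra; ring.
Qed.

End Column.

Definition symmetric_basis : Prop := exists B : 'M[int]_3, B \in unitmx /\
  forall i, P (toR (row i B)) /\ P (- toR (row i B)).

Lemma symmetric_basis_axis u p q e a :
  frame P vx u p q e -> u = zpt p q e (-1) (-1) a ->
  P (pt p q e 0 0 1) -> P (pt p q e 0 0 (-1)) -> symmetric_basis.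
Proof.
move=> tu uE Q1 Qm; have bs := frame_basis tu.
have [t [Qt Qt']] := symmetric_in_column tu uE Q1 Qm.
have uE' : u = zpt q p e (-1) (-1) a by rewrite zpt_swap.
have [s [Qs Qs']] : exists t : int, P (pt q p e 0 1 t%:~R) /\ P (pt q p e 0 (-1) (- t%:~R)).
  by apply: (symmetric_in_column (frame_swap tu) uE'); rewrite pt_swap.
rewrite pt_swap in Qs; rewrite pt_swap in Qs'.
exists (rows3 (zpt p q e 0 0 1) (zpt p q e 0 1 t) (zpt p q e 1 0 s)).
split.
  rewrite zpt_det // (_ : det3 _ _ _ _ _ _ _ _ _ = -1) ?unitrN1 //.
  by rewrite /det3; ring.
have ptN x y z : - pt p q e x y z = pt p q e (- x) (- y) (- z) :> 'rV[R]_3.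
  by rewrite !pt_def; apply/rowP => i; rewrite !mxE; ring.
have rowE (r1 r2 r3 : 'rV[int]_3) : [/\ row 0 (rows3 r1 r2 r3) = r1,
    row 1 (rows3 r1 r2 r3) = r2 & row 2 (rows3 r1 r2 r3) = r3].
  by split; apply/rowP => j; rewrite !mxE.
have [r0 r1 r2] := rowE (zpt p q e 0 0 1) (zpt p q e 0 1 t) (zpt p q e 1 0 s).
by apply: forall_ord3; rewrite ?r0 ?r1 ?r2 toR_zpt ptN oppr0.
Qed.

(** If an axis point is missing, the facet at that end is a triangle at distance 1, and the
edge at the same vertex in direction p serves as well. *)
Lemma corner_symmetric_basis u p q e a :
  frame P vx u p q e -> u = zpt p q e (-1) (-1) a -> symmetric_basis.
Proof.
move=> tu uE.
have rot u' p' q' e' a' : frame P vx u' p' q' e' -> u' = zpt p' q' e' (-1) (-1) a' ->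
  [/\ a' = -1, P (pt p' q' e' 1 0 0) & P (pt p' q' e' (-1) 0 0)] -> symmetric_basis.
  move=> tu' uE' [a1 Q1 Qm].
  apply: (symmetric_basis_axis (frame_rot tu') (a := -1)).
  - by rewrite (zpt_rot p' q' e') uE' a1.
  - by rewrite (pt_rot p' q' e').
  - by rewrite (pt_rot p' q' e').
have [Qm|] := axis_depth bP tu uE; last exact: rot tu uE.
have [n [c [d [n0 tv]]]] := edge_flip bP tu.
have vE : u + n *: e = _ := etrans (congr1 (fun w => w + n *: e) uE) (zpt_flip p q e n c d a).
have [Q1|] := axis_depth bP tv vE; last exact: rot tv vE.
apply: (symmetric_basis_axis tu uE) => //.
by move: Q1; rewrite pt_flip !mulr0 !add0r opprK.
Qed.

End Final.

(** * Smooth lattice polytopes are such bodies *)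

Lemma lattice_basis_unitmx n (B : 'M[int]_n) : lattice_basis B -> B \in unitmx.
Proof.
move=> h.
have /choice[c hc] i : exists c : 'rV[int]_n, delta_mx 0 i = c *m B.
  by have [c [e _]] := h (delta_mx 0 i); exists c.
suff : (\matrix_i c i) *m B = 1%:M by case/mulmx1_unit.
by apply/row_matrixP => i; rewrite row_mul rowK -hc rowE mulmx1.
Qed.

Lemma unitmx_lattice_basis n (B : 'M[int]_n) : B \in unitmx -> lattice_basis B.
Proof.
move=> u z; exists (z *m invmx B); split; first by rewrite mulmxKV.
by move=> c ->; rewrite mulmxK.
Qed.

Lemma primitive_multiple (z : 'rV[int]_3) : z != 0 ->
  exists (n : int) (t : 'rV[int]_3), [/\ 0 < n, primitive_vector t & z = n *: t].
Proof.
move=> z0; pose g := \big[gcdz/0]_(i < 3) z 0 i.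
have gE (F : 'I_3 -> int) : \big[gcdz/0]_(i < 3) F i = gcdz (F 0) (gcdz (F 1) (gcdz (F 2) 0)).
  rewrite !big_ord_recl big_ord0.
  by congr (gcdz (F _) (gcdz (F _) (gcdz (F _) _))); apply: val_inj.
have dvd_gcd (F : 'I_3 -> int) i : (\big[gcdz/0]_(i < 3) F i %| F i)%Z.
  rewrite gE; move: i; apply: forall_ord3.
  - exact: dvdz_gcdl.
  - exact: dvdz_trans (dvdz_gcdr _ _) (dvdz_gcdl _ _).
  - exact: dvdz_trans (dvdz_gcdr _ _) (dvdz_trans (dvdz_gcdr _ _) (dvdz_gcdl _ _)).
have gz i : (g %| z ord0 i)%Z := dvd_gcd _ i.
have g_ge0 : 0 <= g by rewrite /g gE.
have g0 : g != 0.
  apply: contra z0 => /eqP ge; apply/eqP/rowP => i; rewrite mxE.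
  by apply/eqP; move: (gz i); rewrite ge dvd0z.
exists g, (\row_i (z ord0 i %/ g)%Z); split.
- by rewrite lt_neqAle eq_sym g0.
- rewrite /primitive_vector; set t := \row_i _; set g' := \big[gcdz/0]_(i < 3) _.
  have g'0 : 0 <= g' by rewrite /g' gE.
  have gg' i : (g * g' %| z ord0 i)%Z.
    have -> : z 0 i = g * t 0 i by rewrite mxE mulrC divzK.
    by rewrite dvdz_mul // (dvd_gcd (fun i => t 0 i)).
  have : (g * g' %| g * 1)%Z.
    rewrite mulr1 [X in (_ %| X)%Z](gE (fun i => z 0 i)).
    by rewrite !dvdz_gcd !gg' dvdz0.
  by rewrite dvdz_mul2l // dvdz1; lia.
- by apply/rowP => i; rewrite !mxE mulrC divzK.
Qed.

(** A common divisor of the entries divides their combination. *)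
Lemma primitive_of_bezout (z c : 'rV[int]_3) : \sum_i c 0 i * z 0 i = 1 -> primitive_vector z.
Proof.
rewrite big_ord3 => e; rewrite /primitive_vector !big_ord_recl big_ord0.
have -> : lift ord0 (ord0 : 'I_2) = 1 :> 'I_3 by apply: val_inj.
have -> : lift ord0 (lift ord0 (ord0 : 'I_1)) = 2 :> 'I_3 by apply: val_inj.
set g := gcdz _ _.
have g0 : 0 <= g by [].
have d0 : (g %| z ord0 0%R)%Z by exact: dvdz_gcdl.
have d1 : (g %| z ord0 1%R)%Z by exact: dvdz_trans (dvdz_gcdr _ _) (dvdz_gcdl _ _).
have d2 : (g %| z ord0 2%R)%Z by exact: dvdz_trans (dvdz_gcdr _ _) (dvdz_trans (dvdz_gcdr _ _) (dvdz_gcdl _ _)).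
have : (g %| 1%R)%Z by rewrite -e !rpredD // dvdz_mull.
by rewrite dvdz1; lia.
Qed.

Section Smooth.
Variables (R : realType) (V : seq 'rV[R]_3).
Local Notation P := (convex_hull [set` V]).
Hypothesis hlattice : lattice_polytope P.

Lemma vertex_lattice x : is_vertex P x -> exists z, x = toR z.
Proof. by move=> /hlattice[z _ <-]; exists z. Qed.

Definition lattice_vertex : set 'rV[int]_3 := [set z | is_vertex P (toR z)].

Lemma edge_direction_of w s : w != s -> is_edge P (segment (toR w) (toR s)) ->
  exists (n : int) z, [/\ 0 < n, s = w + n *: z & edge_direction P (toR w) z].
Proof.
move=> ws he; have [|n [z [n0 zp zE]]] := @primitive_multiple (s - w).
  by rewrite subr_eq0 eq_sym.
have sE : s = w + n *: z by rewrite -zE addrC subrK.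
exists n, z; split=> //; split=> //; exists n%:~R; rewrite ltr0z; split=> //.
by rewrite -toRZ -toRD -sE.
Qed.

(** If a coordinate in the basis of edge directions were negative somewhere on P, some
edge at w would have a negative coordinate, but the edge directions have coordinates
0 and 1. Edge lengths are integers because they are the coordinates of differences of
lattice vertices. *)
Lemma smooth_frame B w : lattice_vertex w -> lattice_basis B ->
  (forall z, edge_direction P (toR w) z <-> exists i, z = row i B) ->
  frame P lattice_vertex w (row 0 B) (row 1 B) (row 2 B).
Proof.
move=> vw /lattice_basis_unitmx uB hB.
pose N : 'M[R]_3 := map_mx intr (invmx B).
pose phi i : 'rV[R]_3 := (col i N)^T.
have phiE i y : dot (phi i) y = (y *m N) 0 i.
  by rewrite mxE; apply: eq_bigr => j _; rewrite !mxE mulrC.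
have phiZ i z : dot (phi i) (toR z) = ((z *m invmx B) 0 i)%:~R.
  by rewrite phiE /N /toR -map_mxM mxE.
have phi_row i k : dot (phi i) (toR (row k B)) = (k == i)%:R.
  by rewrite phiZ -row_mul mulmxV // !mxE; case: (k == i).
have phi_ge0 i v : v \in V -> 0 <= dot (phi i) (v - toR w).
  move=> vV; rewrite leNgt; apply/negP => neg.
  have [s [ws sv he sneg]] := @improving_edge _ _ V (toR w) (phi i) vw (ex_intro2 _ _ v vV neg).
  have [s0 sE] := vertex_lattice sv; rewrite {}sE in ws sv he sneg.
  have [|n [z [n0 sE]]] := @edge_direction_of w s0 _ he.
    by apply: contra ws => /eqP ->.
  move=> /hB[k zE]; move: sneg; rewrite sE toRD toRZ addrAC subrr add0r dotZr zE phi_row.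
  by rewrite ltNge mulr_ge0 // ?ler0z ?ler0n // ltW.
have rows_in r : r \in [:: row 0 B; row 1 B; row 2 B] -> exists i, r = row i B.
  by rewrite !inE => /or3P[] /eqP ->; [exists 0|exists 1|exists 2].
have rowsB : rows3 (row 0 B) (row 1 B) (row 2 B) = B.
  by apply/matrixP => i j; move: i; apply: forall_ord3; rewrite !mxE.
split=> //.
- by rewrite rowsB.
- move=> x Px; pose c i := dot (phi i) (x - toR w).
  have c0 i : 0 <= c i.
    have := @hull_aff_ge0 _ _ _ (phi i, - dot (phi i) (toR w)) x _ Px.
    rewrite /aff /= /c dotBr; apply => v vV /=.
    by rewrite -dotBr phi_ge0.
  exists (c 0), (c 1), (c 2); split=> //.
  have -> : x = toR w + (x - toR w) *m N *m map_mx intr B.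
    rewrite -mulmxA -map_mxM mulVmx // map_mx1 mulmx1 addrC subrK //.
  congr (_ + _); rewrite mulmx_sum_row big_ord3 /c !phiE.
  by rewrite -!map_row.
- move=> r /rows_in[i rE].
  have [_ [l [l0 he]]] := (hB r).2 (ex_intro _ i rE).
  have sv := edge_end (dim1_neq he.2) he.1.
  have [s sE] := vertex_lattice sv.
  have lE : l = (((s - w) *m invmx B) 0 i)%:~R.
    rewrite -phiZ toRD toRN -sE addrAC subrr add0r dotZr rE phi_row eqxx.
    by rewrite mulr1.
  exists (((s - w) *m invmx B) 0 i); first by rewrite -(ltr0z R) -lE.
  by rewrite /lattice_vertex /= toRD toRZ -lE.
Qed.

Lemma polytope_body : interior P 0 ->
  (forall w, lattice_vertex w -> exists B, lattice_basis B /\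
     forall z, edge_direction P (toR w) z <-> exists i, z = row i B) ->
  body P lattice_vertex.
Proof.
move=> h0 hB; split.
- by move=> x y s t; apply: hull_convex.
- have /nbhs_ballP[d /= d0 hd] := h0.
  exists (d / 2); first by rewrite divr_gt0.
  move=> x hx; apply: hd; split=> // i j; rewrite ord1 mxE /ball /= sub0r normrN.
  by apply: le_lt_trans (hx j) _; lra.
- exists (\sum_(v <- V) \sum_i `|v 0 i|) => x Px i.
  set K := \sum_(v <- V) _.
  have vK v : v \in V -> `|v 0 i| <= K.
    move=> vV; rewrite /K (big_rem _ vV) /= (bigD1 i) //= -addrA lerDl addr_ge0 //.
      by apply: sumr_ge0.
    by apply: sumr_ge0 => ? _; apply: sumr_ge0.
  have h1 : 0 <= x 0 i + K.
    have := @hull_aff_ge0 _ _ _ (delta_mx 0 i, K) x _ Px.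
    rewrite /aff /= dot_delta; apply => v /= /vK.
    by rewrite dot_delta ler_norml; lra.
  have h2 : 0 <= - x 0 i + K.
    have := @hull_aff_ge0 _ _ _ (- delta_mx 0 i, K) x _ Px.
    rewrite /aff /= dotNl dot_delta; apply => v /= /vK.
    by rewrite dotNl dot_delta ler_norml; lra.
  by rewrite ler_norml; lra.
- by move=> w /vertex_in.
- move=> f g.
  have [||l [w [p [wv Pp gw ew hl]]]] := @slice_min _ _ V f g 0.
  + exact: interior_subset h0.
  + exact: dot0r.
  have [w0 wE] := vertex_lattice wv; subst w.
  by exists l, w0, p.
- move=> w vw; have [B [bB hBw]] := hB w vw.
  by exists (row 0 B), (row 1 B), (row 2 B); apply: smooth_frame.
Qed.

End Smooth.

(** * Facets at lattice distance one *)

(** The plane x = ux cuts P in a facet through the edge, since it contains u, u + q and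
u + e. Its lattice distance to the origin is the absolute value of ux; it is at most 1,
and ux < 0 as the origin is inside P. *)
Lemma facet_height (R : realType) (P F : set 'rV[R]_3) vx u p q e ux uy uz :
  body P vx -> frame P vx u p q e -> u = zpt p q e ux uy uz ->
  F `<=` P -> (forall x, F x -> exists t : R, x = toR u + t *: toR e) ->
  ubound (facet_distances P F 0) 1 -> ux = -1.
Proof.
move=> bP tu uE FP Fe ub; have bs := frame_basis tu.
(* The coordinate x, as an integral functional. *)
pose W : 'rV[int]_3 := (col 0 (invmx (rows3 p q e)))^T.
have dotW (t : 'rV[int]_3) : \sum_i t 0 i * W 0 i = (t *m invmx (rows3 p q e)) 0 0.
  by rewrite mxE; apply: eq_bigr => i _; rewrite !mxE.
have WE x y z : \sum_i (zpt p q e x y z) 0 i * W 0 i = x.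
  by rewrite dotW /zpt -mul_row3 mulmxK // mxE.
have dotWR (t : 'rV[int]_3) : dot (toR W) (toR t) = (\sum_i t 0 i * W 0 i)%:~R :> R.
  by rewrite rmorph_sum; apply: eq_bigr => i _; rewrite !mxE rmorphM mulrC.
have Wpt x y z : dot (toR W) (pt p q e x y z) = x :> R.
  rewrite pt_def !dotDr !dotZr !dotWR {1}(zpt100 p q e) {2}(zpt010 p q e) {3}(zpt001 p q e).
  by rewrite !WE !mulr0 mulr1 !addr0.
pose G := P `&` [set x | dot (toR W) x = ux%:~R].
have uG : toR u = pt p q e ux%:~R uy%:~R uz%:~R :> 'rV[R]_3 by rewrite uE toR_zpt.
have Gu : G (toR u).
  by split; [exact: (body_vx bP (frame_vx tu))|rewrite /= uG Wpt].
have Gq : G (toR (u + q)).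
  split; first by have := frame_end bP (frame_swap tu).
  by rewrite /= uE {2}(zpt010 p q e) zptD toR_zpt Wpt addr0.
have Ge : G (toR (u + e)).
  split; first by have := frame_end bP (frame_rot (frame_rot tu)).
  by rewrite /= uE {2}(zpt001 p q e) zptD toR_zpt Wpt addr0.
have plane_comb (s t : R) : affine_hull G (toR u + (s *: toR q + t *: toR e)).
  exists 3%N, (fun i : 'I_3 => if i == 0 then toR u else if i == 1 then toR (u + q) else toR (u + e)),
    (fun i : 'I_3 => if i == 0 then 1 - s - t else if i == 1 then s else t).
  split; first by apply: forall_ord3.
    by rewrite big_ord3 /=; ring.
  by rewrite big_ord3 /= !toRD; apply/rowP => i; rewrite !mxE; ring.
have hullG : affine_hull G = [set y | dot (toR W) y = ux%:~R].
  apply/seteqP; split=> y /=.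
    move=> [k [x [c [hx c1 ->]]]]; rewrite dot_sumr.
    under eq_bigr => i _ do rewrite (hx i).2.
    by rewrite -mulr_suml c1 mul1r.
  have [a [b [c ->]]] := pt_surj bs y; rewrite Wpt => ->.
  have -> : pt p q e ux%:~R b c = toR u + ((b - uy%:~R) *: toR q + (c - uz%:~R) *: toR e).
    by rewrite uG !pt_def; apply/rowP => i; rewrite !mxE; ring.
  exact: plane_comb.
have corner x : P x -> ux%:~R <= dot (toR W) x.
  have [a [b [c ->]]] := pt_surj bs x.
  by move: (tu); rewrite {1}uE => tu' /(corner_ge tu')[+ _ _]; rewrite Wpt.
have facetG : is_facet P G.
  split.
    exists (- toR W), (- ux%:~R); split=> [x /corner|].
      by rewrite dotNl lerN2.
    by apply/seteqP; split=> x [Px /= ex]; split=> //=; [rewrite dotNl ex|move: ex; rewrite dotNl => /oppr_inj].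
  exists (toR u), (\matrix_(i < 2, j < 3) (if i == 0 then toR q 0 j else toR e 0 j)).
  have mulD (v : 'rV[R]_2) : v *m (\matrix_(i < 2, j < 3) (if i == 0 then toR q 0 j else toR e 0 j))
      = v 0 0 *: toR q + v 0 1 *: toR e.
    apply/rowP => j; rewrite !mxE big_ord_recl big_ord1 !mxE /=.
    by congr (_ + v _ _ * _); apply: val_inj.
  split.
    apply: inj_row_free => v; rewrite mulD => v0.
    have := @pt_inj R p q e bs 0 (v 0 0) (v 0 1) 0 0 0.
    rewrite !pt_def !scale0r !add0r => /(_ v0)[_ v00 v01].
    apply/rowP => i; rewrite mxE; case: i => [[|[|//]]] Hi.
      by rewrite -[RHS]v00; congr (v _ _); apply: val_inj.
    by rewrite -[RHS]v01; congr (v _ _); apply: val_inj.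
  apply/seteqP; split=> y.
    rewrite hullG /=; have [a [b [c ->]]] := pt_surj bs y; rewrite Wpt => ->.
    exists (\row_i (if i == 0 then b - uy%:~R else c - uz%:~R)) => //.
    rewrite mulD !mxE /= uG !pt_def.
    by apply/rowP => i; rewrite !mxE; ring.
  by move=> [v _ <-]; rewrite mulD; exact: plane_comb.
have dist : facet_distances P F 0 `|ux%:~R|.
  exists G; split=> //.
    move=> x Fx; split; first exact: FP.
    have [t ->] := Fe x Fx; rewrite /= uG dotDr dotZr Wpt dotWR {1}(zpt001 p q e) WE.
    by rewrite mulr0 addr0.
  exists W, ux%:~R; split=> //.
    by apply: (@primitive_of_bezout _ p); rewrite {1}(zpt100 p q e) WE.
  by rewrite dot0r subr0.
have ux0 : ux < 0.
  have [d d0 hd] := pt_around p q e bP.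
  have := corner (pt p q e (- d) 0 0); rewrite Wpt => /(_ _) h.
  have : ux%:~R <= - d.
    by apply: h; apply: hd; rewrite ?normr0 ?normrN ?(gtr0_norm d0) ?(ltW d0).
  rewrite -(ltr_int R); lra.
have := ub _ dist; rewrite ltr0_norm ?ltrz0 // -intrN (ler_int R _ 1); lia.
Qed.

Theorem proposition7p7 (R : realType) (P : set 'rV[R]_3) (u v : 'rV[R]_3)
  (hP : polytope P) (hdim : has_dim P 3)
  (hsmooth : smooth_polytope P) (hlattice : lattice_polytope P)
  (h0 : interior P 0)
  (huv : is_edge P (segment u v))
  (hnext : next_to P (segment u v) 0) :
  exists B : 'M[int]_3, lattice_basis B /\ forall i, calE P (toR (row i B)).
Proof.
have [A [/finite_seqP[V AE] PE]] := hP; subst A.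
rewrite {}PE in hP hdim hsmooth hlattice h0 huv hnext *.
have [_ _ hB] := hsmooth.
have bP := polytope_body hlattice h0 (fun w => hB (toR w)).
have uv := dim1_neq huv.2.
have uv' : v != u by rewrite eq_sym.
have vu : is_vertex (convex_hull [set` V]) u.
  by apply: (edge_end uv'); rewrite segmentC; exact: huv.1.
have vv := edge_end uv huv.1.
have [u0 uE] := vertex_lattice hlattice vu.
have [v0 vE] := vertex_lattice hlattice vv.
rewrite {}uE {}vE in huv hnext uv vu vv uv'.
have uv0 : u0 != v0 by apply: contra uv => /eqP ->.
have [n [z [n0 zE zdir]]] := edge_direction_of uv0 huv.
have [B [bB hBz]] := hB _ vu.
have tB := smooth_frame hlattice vu bB hBz.
have [p [q tz]] : exists p q, frame (convex_hull [set` V]) (lattice_vertex V) u0 p q z.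
  have [i ->] := (hBz z).1 zdir; move: i; apply: forall_ord3.
  - by exists (row 1 B), (row 2 B); apply: frame_rot.
  - by exists (row 2 B), (row 0 B); apply: frame_rot; apply: frame_rot.
  - by exists (row 0 B), (row 1 B).
have [ux [uy [uz uE]]] := zpt_surj (frame_basis tz) u0.
have FP := face_sub huv.1.
have Fz x : segment (toR u0) (toR v0) x -> exists t : R, x = toR u0 + t *: toR z.
  move=> /segmentP[t [_ _ ->]]; exists (t * n%:~R).
  by rewrite zE toRD toRZ addrAC subrr add0r scalerA.
have ub := hnext.2.2.
have ux1 := facet_height bP tz uE FP Fz ub.
have uE' : u0 = zpt q p z uy ux uz by rewrite zpt_swap.
have uy1 := facet_height bP (frame_swap tz) uE' FP Fz ub.
rewrite ux1 uy1 in uE.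
have [C [uC hC]] := corner_symmetric_basis bP tz uE.
exists C; split; first exact: unitmx_lattice_basis.
move=> i; have [Ci Ci'] := hC i; split; first by split=> //; exists (row i C).
by exists (- toR (row i C)); rewrite ?opprK.
Qed.
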